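(* Let $\overline f_i=\overline f_i(v)\ge0$ $(i=1,\dots,N)$ be fixed dimensionless distributions, integrable, not almost everywhere zero, and with finite classical moments $n_i^{\mathrm{nr}},u_i^{\mathrm{nr}},T_i^{\mathrm{nr}}$. For $\varepsilon>0$ let $\overline{\mathcal{J}}_i(\overline f)$ be the dimensionless form of the relativistic attractor $\mathcal{J}_i(f)$, that is $$\overline{\mathcal{J}}_i(\overline f)(v)=\frac{\int_{\mathbb{R}^3}\overline f_i\,\frac{dv}{\sqrt{1+|\varepsilon v|^2}}}{\int_{\mathbb{R}^3}e^{-m_ic^2\widetilde\beta\sqrt{1+|\varepsilon v|^2}}\,\frac{dv}{\sqrt{1+|\varepsilon v|^2}}}\exp\left\{-m_ic^2\widetilde\beta\left(\overline U^0\sqrt{1+|\varepsilon v|^2}-\varepsilon\overline U\cdot v\right)\right\},$$ with $\overline U^\mu=(\overline U^0,\overline U)$ and $\widetilde\beta$ (both depending on $\varepsilon$) as defined in the context. Then in the Newtonian limit $$\overline{\mathcal{J}}_i(\overline f)(v)\to\mathcal{M}_i(\overline f)(v)\quad\text{as }\varepsilon\to0,\qquad v\in\mathbb{R}^3,\ i=1,\dots,N,$$ where $$\mathcal{M}_i(\overline f)(v)=n_i^{\mathrm{nr}}\left(\frac{m_i}{2\pi T^{\mathrm{nr}}}\right)^{3/2}e^{-m_i|v-U^{\mathrm{nr}}|^2/2T^{\mathrm{nr}}}.$$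
   Context: Constants $c>0$ (speed of light), and $m_i>0$ (rest mass), $\tau_i>0$ (relaxation time) for $i=1,\dots,N$. Scaling (the variables $t,x$ are suppressed; they are parameters): with typical time $s$, typical length $L$, typical number density $\mathcal{N}$ and typical momenta $\mu_i=m_iL/s$, write $p_i=\mu_iv$ and $$f_i(p_i)=\frac{\mathcal{N}}{\mu_i^3}\overline f_i(v),\qquad \varepsilon=\frac{\mu_i}{cm_i}=\frac{L}{cs},\qquad \nu_i=\frac{s}{\tau_i}.$$ The quantities $c$, $m_i$, $\nu_i$ and $\overline f_i$ are independent of $\varepsilon$. Definition of $\widetilde\beta$: with $p_i^0=\sqrt{(cm_i)^2+|p_i|^2}$, $p_i^\mu=(p_i^0,p_i)$, $n_iU_i^\mu=c\int_{\mathbb{R}^3}p_i^\mu f_i\frac{dp_i}{p_i^0}$, and $a^\mu b_\mu=a^0b^0-\sum_{k=1}^3a^kb^k$, $\widetilde\beta$ is the unique positive solution of $$\sum_{i=1}^{N}\frac{m_i}{\tau_i}\frac{\int_{\mathbb{R}^3}e^{-c\widetilde\beta p_i^0}\,dp_i}{\int_{\mathbb{R}^3}e^{-c\widetilde\beta p_i^0}\frac{dp_i}{p_i^0}}\int_{\mathbb{R}^3}f_i\,\frac{dp_i}{p_i^0}=\frac1c\left[\left(\sum_{i=1}^N\frac{m_i}{\tau_i}n_iU_i^\mu\right)\left(\sum_{j=1}^N\frac{m_j}{\tau_j}n_jU_{j\mu}\right)\right]^{1/2}.$$ Definition of $\overline U^\mu$: $$\overline U^\mu=\frac{\sum_{i=1}^N\frac{m_i}{\tau_i}\left(\int_{\mathbb{R}^3}\overline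 f_i\,dv,\ \varepsilon\int_{\mathbb{R}^3}v\overline f_i\frac{dv}{\sqrt{1+|\varepsilon v|^2}}\right)}{\sqrt{\left(\sum_{i=1}^N\frac{m_i}{\tau_i}\int_{\mathbb{R}^3}\overline f_i\,dv\right)^2-\left|\sum_{i=1}^N\frac{m_i}{\tau_i}\varepsilon\int_{\mathbb{R}^3}v\overline f_i\frac{dv}{\sqrt{1+|\varepsilon v|^2}}\right|^2}}.$$ Classical quantities: $$n_i^{\mathrm{nr}}=\int_{\mathbb{R}^3}\overline f_i\,dv,\quad u_i^{\mathrm{nr}}=\frac1{n_i^{\mathrm{nr}}}\int_{\mathbb{R}^3}v\overline f_i\,dv,\quad T_i^{\mathrm{nr}}=\frac{m_i}{3n_i^{\mathrm{nr}}}\int_{\mathbb{R}^3}|v-u_i^{\mathrm{nr}}|^2\overline f_i\,dv,$$ $$U^{\mathrm{nr}}=\frac{\sum_{i=1}^N\nu_im_in_i^{\mathrm{nr}}u_i^{\mathrm{nr}}}{\sum_{i=1}^N\nu_im_in_i^{\mathrm{nr}}},\qquad \frac32\Big(\sum_{i=1}^N\nu_in_i^{\mathrm{nr}}\Big)T^{\mathrm{nr}}=\sum_{i=1}^N\nu_i\Big[\frac12m_in_i^{\mathrm{nr}}\big(|u_i^{\mathrm{nr}}|^2-|U^{\mathrm{nr}}|^2\big)+\frac32n_i^{\mathrm{nr}}T_i^{\mathrm{nr}}\Big].$$ *)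

(* Defs.v *)
From HB Require Import structures.
From mathcomp Require Import all_boot all_order all_algebra.
From mathcomp Require Import all_classical all_reals all_analysis.

Set Implicit Arguments.
Unset Strict Implicit.
Unset Printing Implicit Defensive.
Import Order.TTheory GRing.Theory Num.Theory.
Import numFieldNormedType.Exports.
Local Open Scope classical_set_scope.
Local Open Scope ring_scope.

Notation vec3 R := (R * R * R)%type.
Notation vec4 R := (R * (R * R * R))%type.

(* Instance resolution does not find the library's sigma-finite structure on
   [_ \x _], which Fubini's theorem needs for [leb2 \x lebesgue_measure];
   hence the explicit instances on [leb2] and [leb3]. *)
Lemma sigma_finite_product d1 d2 (T1 : measurableType d1)
    (T2 : measurableType d2) (R : realType)
    (m1 : {sigma_finite_measure set T1 -> \bar R})
    (m2 : {sigma_finite_measure set T2 -> \bar R}) :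
  sigma_finite setT (m1 \x m2)%E.
Proof.
have /sigma_finiteP[F [TF ndF Foo]] := sigma_finiteT m1.
have /sigma_finiteP[G [TG ndG Goo]] := sigma_finiteT m2.
exists (fun n => F n `*` G n).
  rewrite -setXTT TF TG predeqE => -[x y]; split.
    move=> [/= [n _ Fnx] [k _ Gky]]; exists (maxn n k) => //; split.
      by move: x Fnx; exact/subsetPset/ndF/leq_maxl.
    by move: y Gky; exact/subsetPset/ndG/leq_maxr.
  by move=> [n _ []/= ? ?]; split; exists n.
move=> k; have [? ?] := Foo k; have [? ?] := Goo k.
split; first exact: measurableX.
by rewrite product_measure1E// lte_mul_pinfty// ge0_fin_numE.
Qed.

Definition leb2 (R : realType) :=
  (@lebesgue_measure R \x @lebesgue_measure R)%E.
Arguments leb2 : clear implicits.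

HB.instance Definition _ (R : realType) := Measure.on (leb2 R).
HB.instance Definition _ (R : realType) :=
  Measure_isSigmaFinite.Build _ _ _ (leb2 R)
    (sigma_finite_product (@lebesgue_measure R) (@lebesgue_measure R)).

Definition leb3 (R : realType) := (leb2 R \x @lebesgue_measure R)%E.
Arguments leb3 : clear implicits.

HB.instance Definition _ (R : realType) := Measure.on (leb3 R).
HB.instance Definition _ (R : realType) :=
  Measure_isSigmaFinite.Build _ _ _ (leb3 R)
    (sigma_finite_product (leb2 R) (@lebesgue_measure R)).

Section Kinetic.
Context {R : realType} {N : nat}.
Implicit Types (c b eps mu Nd T : R) (f : vec3 R -> R) (v p : vec3 R).

(* The library norm on a product is the max norm, so squared Euclidean lengths
   are written [dot v v]. *)
Definition dot (v w : vec3 R) : R :=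
  v.1.1 * w.1.1 + v.1.2 * w.1.2 + v.2 * w.2.

(* Signature (+,-,-,-). *)
Definition minkowski (a b : vec4 R) : R := a.1 * b.1 - dot a.2 b.2.

Definition int3 f : R := \int[leb3 R]_v f v.

Definition vint3 (F : vec3 R -> vec3 R) : vec3 R :=
  (int3 (fun v => (F v).1.1), int3 (fun v => (F v).1.2), int3 (fun v => (F v).2)).

Definition integrable3 f : Prop := (leb3 R).-integrable setT (EFin \o f).

(** Classical moments *)

Definition n_nr f : R := int3 f.

Definition u_nr f : vec3 R := (n_nr f)^-1 *: vint3 (fun v => f v *: v).

Definition T_nr (m : R) f : R :=
  m / (3 * n_nr f) * int3 (fun v => dot (v - u_nr f) (v - u_nr f) * f v).

Definition finite_moments f : Prop :=
  [/\ integrable3 f,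
      integrable3 (fun v => v.1.1 * f v),
      integrable3 (fun v => v.1.2 * f v),
      integrable3 (fun v => v.2 * f v) &
      integrable3 (fun v => dot (v - u_nr f) (v - u_nr f) * f v)].

Definition mix_U (nu m : 'I_N -> R) (f : 'I_N -> vec3 R -> R) : vec3 R :=
  (\sum_(i < N) nu i * m i * n_nr (f i))^-1 *:
    \sum_(i < N) (nu i * m i * n_nr (f i)) *: u_nr (f i).

(* The solution T of (3/2) (sum_i nu_i n_i) T = sum_i nu_i [...]. *)
Definition mix_T (nu m : 'I_N -> R) (f : 'I_N -> vec3 R -> R) : R :=
  let U := mix_U nu m f in
  (\sum_(i < N) nu i *
     (2^-1 * m i * n_nr (f i) * (dot (u_nr (f i)) (u_nr (f i)) - dot U U)
      + 3 / 2 * n_nr (f i) * T_nr (m i) (f i)))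
  / (3 / 2 * \sum_(i < N) nu i * n_nr (f i)).

Definition maxwellian (nu m : 'I_N -> R) (f : 'I_N -> vec3 R -> R)
    (i : 'I_N) (v : vec3 R) : R :=
  let T := mix_T nu m f in
  let U := mix_U nu m f in
  n_nr (f i) * (m i / (2 * pi * T)) `^ (3 / 2)
    * expR (- (m i * dot (v - U) (v - U) / (2 * T))).

(** Relativistic quantities *)

Definition p0 c (m : R) p : R := Num.sqrt ((c * m) ^+ 2 + dot p p).

Definition current c (m : R) f : vec4 R :=
  c *: (int3 (fun p => p0 c m p * f p / p0 c m p),
        vint3 (fun p => (f p / p0 c m p) *: p)).

Definition betat_solution c (m tau : 'I_N -> R) (f : 'I_N -> vec3 R -> R) b
    : Prop :=
  let V : vec4 R := \sum_(i < N) (m i / tau i) *: current c (m i) (f i) in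
  0 < b /\
  \sum_(i < N) m i / tau i
     * (int3 (fun p => expR (- (c * b * p0 c (m i) p)))
        / int3 (fun p => expR (- (c * b * p0 c (m i) p)) / p0 c (m i) p))
     * int3 (fun p => f i p / p0 c (m i) p)
  = c^-1 * Num.sqrt (minkowski V V).

(** Dimensionless quantities *)

(* f(p) = Nd / mu^3 * fbar(v) with p = mu v. *)
Definition dimensional Nd mu (fbar : vec3 R -> R) : vec3 R -> R :=
  fun p => Nd / mu ^+ 3 * fbar (mu^-1 *: p).

Definition gam eps v : R := Num.sqrt (1 + dot (eps *: v) (eps *: v)).

Definition Ubar (m tau : 'I_N -> R) (f : 'I_N -> vec3 R -> R) eps : vec4 R :=
  let A := \sum_(i < N) m i / tau i * int3 (f i) in
  let B := \sum_(i < N) (m i / tau i) *: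
             (eps *: vint3 (fun v => (f i v / gam eps v) *: v)) in
  (Num.sqrt (A ^+ 2 - dot B B))^-1 *: (A, B).

(* [b] stands for the value of beta-tilde at [eps]. *)
Definition Jbar c (m tau : 'I_N -> R) (f : 'I_N -> vec3 R -> R) eps b
    (i : 'I_N) (v : vec3 R) : R :=
  let U := Ubar m tau f eps in
  int3 (fun w => f i w / gam eps w)
  / int3 (fun w => expR (- (m i * c ^+ 2 * b * gam eps w)) / gam eps w)
  * expR (- (m i * c ^+ 2 * b * (U.1 * gam eps v - dot (eps *: U.2) v))).

End Kinetic.

(* Main.v *)
Require Import Defs.
From HB Require Import structures.
From mathcomp Require Import all_boot all_order all_algebra.
From mathcomp Require Import all_classical all_reals all_analysis.
From mathcomp Require Import measurable_realfun.
From mathcomp Require Import ring lra.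
Set Implicit Arguments.
Unset Strict Implicit.
Unset Printing Implicit Defensive.
Import Order.TTheory GRing.Theory Num.Theory.
Import numFieldNormedType.Exports.
Local Open Scope classical_set_scope.
Local Open Scope ring_scope.

(** Put [y = c^2 betat] and [x_i = m_i y]; everything reduces to the claim
    [eps^2 y --> 1 / T], where [T] is the temperature of the mixture.

    In dimensionless variables the equation for [betat] reads
      [sum_i nu_i m_i r(x_i) J_i(eps) = S(eps)],
    where [J_i(eps)] is the integral of [f_i / gam eps], [S(eps)] is the Minkowski
    length of the total flux, and [r(x)] is the mean of the Lorentz factor under
    the weight [exp(- x gam) / gam] ([betat_equation]).  The dilation [w = eps v]
    shows that [r] does not depend on [eps].  Subtracting [sum_i nu_i m_i J_i]
    leaves [r - 1], the mean kinetic energy, on the left, and on the right a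
    quantity equivalent to [eps^2 (3/2) (sum_i nu_i n_i) T]
    ([excess_balance], [cvg_energy_balance]): the expansions of [1 / gam] and of
    [S] to second order in [eps] are exactly the definition of [T].

    Since [r] decreases and stays above 1 ([mean_gam_nonincreasing],
    [mean_gam_gt1]), a right-hand side tending to 0 forces [y --> +oo].  At large
    [x] the weight, after the dilation [w = u / sqrt x], tends to a Gaussian, and
    [x (r(x) - 1) --> 3 / 2] ([cvg_thermal_ratio]); this is equipartition of
    energy.  So [y] times the left-hand side tends to [(3/2) sum_i nu_i n_i], and
    comparison of the two sides gives [eps^2 y --> 1 / T] ([cvg_coldness]).

    The factor [exp(- x_i)] is common to the numerator and the denominator of
    the attractor.  Once it is cancelled, the normalisation and the exponent are
    explicit functions of [eps^2 x_i] and of quantities with known limits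
    ([JbarE]), and the limits combine to the Maxwellian by completing the square
    in [v].  All limits of integrals come from dominated convergence; products of
    Cauchy densities dominate the relativistic exponentials
    ([expR_kin_dominated]). *)

(** * Dilations of Lebesgue measure *)

(** The Borel sigma-algebra of [R^3], on the carrier where [leb3] lives. *)
Definition measurable3 (R : realType) (f : vec3 R -> R) : Prop :=
  measurable_fun (setT : set (vec3 (measurableTypeR R))) f.

Lemma integrable3_measurable (R : realType) (f : vec3 R -> R) :
  integrable3 f -> measurable3 f.
Proof. by move=> /integrableP[/measurable_EFinP]. Qed.

Lemma measurable3_x (R : realType) : measurable3 (fun v : vec3 R => v.1.1).
Proof. exact: (measurableT_comp measurable_fst measurable_fst). Qed.

Lemma measurable3_y (R : realType) : measurable3 (fun v : vec3 R => v.1.2).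
Proof. exact: (measurableT_comp measurable_snd measurable_fst). Qed.

Lemma measurable3_z (R : realType) : measurable3 (fun v : vec3 R => v.2).
Proof. exact: measurable_snd. Qed.

Lemma measurable3D (R : realType) (f g : vec3 R -> R) :
  measurable3 f -> measurable3 g -> measurable3 (fun v => f v + g v).
Proof. exact: measurable_realfun.measurable_funD. Qed.

Lemma measurable3M (R : realType) (f g : vec3 R -> R) :
  measurable3 f -> measurable3 g -> measurable3 (fun v => f v * g v).
Proof. exact: measurable_realfun.measurable_funM. Qed.

Lemma measurable3_comp (R : realType) (h : R -> R) (f : vec3 R -> R) :
  continuous h -> measurable3 f -> measurable3 (fun v => h (f v)).
Proof.
by move=> ch mf; apply: (measurableT_comp (continuous_measurable_fun ch) mf).
Qed.

(** Carries the proof that [phi] is measurable, on which the measure structure of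
    [pushforward m phi] depends. *)
Definition image_measure d1 d2 (T1 : measurableType d1) (T2 : measurableType d2)
    (R : realType) (m : {measure set T1 -> \bar R}) (phi : T1 -> T2)
    (mphi : measurable_fun setT phi) : {measure set T2 -> \bar R} :=
  measure_function_pushforward__canonical__measure_function_Measure m mphi.

Section Dilation.
Local Open Scope ereal_scope.

Lemma measurable_dilation (R : realType) (a : R) :
  measurable_fun (setT : set (measurableTypeR R))
    (fun x => (a * x)%R : measurableTypeR R).
Proof. exact: mulrl_measurable. Qed.

(** Both sides are measures in [A], so it is enough to compare half-open intervals. *)
Lemma lebesgue_measure_dilation (R : realType) (a : R)
    (A : set (measurableTypeR R)) : (0 < a)%R -> measurable A ->
  a%:E * lebesgue_measure ((fun x : measurableTypeR R => a * x)%R @^-1` A)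
  = lebesgue_measure A.
Proof.
move=> a0 mA; pose k := NngNum (ltW a0).
pose mf := measurable_dilation a.
have := @lebesgue_measure_unique R
  (mscale k (image_measure (@lebesgue_measure R) mf)).
move=> /(_ _ A mA) /= -> //.
move=> _ [[x y]] _ <-.
rewrite /mscale/= /pushforward/=.
set B := (X in _ = _ * lebesgue_measure X).
have -> : B = `](a^-1 * x)%R, (a^-1 * y)%R]%classic.
  apply/seteqP; split=> t /=; rewrite !in_itv/=;
  by rewrite !ltr_pdivrMl// !ler_pdivlMl.
rewrite !lebesgue_measure_itv/= !lte_fin ltr_pM2l ?invr_gt0//.
case: ifP => _; last by rewrite mule0.
by rewrite -EFinD -EFinM -mulrBr mulrA divff ?mul1r// gt_eqF.
Qed.

Lemma ge0_integral_measure_dilation d (T : measurableType d) (R : realType)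
    (m : {measure set T -> \bar R}) (phi : T -> T) (k : R) (f : T -> \bar R) :
  measurable_fun setT phi -> (0 <= k)%R ->
  (forall A, measurable A -> k%:E * m (phi @^-1` A) = m A) ->
  measurable_fun setT f -> (forall x, 0 <= f x) ->
  \int[m]_x f x = k%:E * \int[m]_x f (phi x).
Proof.
move=> mphi k0 H mf f0.
pose mu := image_measure m mphi.
rewrite (eq_measure_integral (mscale (NngNum k0) mu)); last first.
  by move=> A mA _; rewrite -[LHS]H.
rewrite ge0_integral_mscale// (ge0_integral_pushforward mphi)//.
Qed.

(** A product measure is determined by its values on rectangles, and there the
    two factors multiply. *)
Lemma product_measure_dilation d1 d2 (T1 : measurableType d1)
    (T2 : measurableType d2) (R : realType)
    (m1 : {sigma_finite_measure set T1 -> \bar R})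
    (m2 : {sigma_finite_measure set T2 -> \bar R})
    (f1 : T1 -> T1) (f2 : T2 -> T2) (k1 k2 : R) :
  measurable_fun setT f1 -> measurable_fun setT f2 ->
  (0 <= k1)%R -> (0 <= k2)%R ->
  (forall A, measurable A -> k1%:E * m1 (f1 @^-1` A) = m1 A) ->
  (forall A, measurable A -> k2%:E * m2 (f2 @^-1` A) = m2 A) ->
  forall A, measurable A ->
    (k1 * k2)%:E * (m1 \x m2) ((fun z => (f1 z.1, f2 z.2)) @^-1` A)
    = (m1 \x m2) A.
Proof.
move=> mf1 mf2 k10 k20 H1 H2 A mA.
have mF : measurable_fun (setT : set (T1 * T2)) (fun z => (f1 z.1, f2 z.2)).
  by apply: measurable_fun_pair => /=; apply: measurableT_comp.
pose k := NngNum (mulr_ge0 k10 k20).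
have := @product_measure_unique _ _ _ _ _ m1 m2
  (mscale k (image_measure (m1 \x m2) mF)).
move=> /(_ _ A mA) -> //.
move=> B C mB mC; rewrite /mscale/= /pushforward/=.
have mpre d (T : measurableType d) (g : T -> T) X :
    measurable_fun setT g -> measurable X -> measurable (g @^-1` X).
  by move=> mg mX; rewrite -(setTI (g @^-1` X)); exact: mg.
transitivity ((k1 * k2)%:E * (m1 \x m2) ((f1 @^-1` B) `*` (f2 @^-1` C))) => //.
rewrite product_measure1E; [|exact: mpre..].
by rewrite -(H1 B mB) -(H2 C mC) EFinM muleACA.
Qed.

Lemma leb3_dilation (R : realType) (a : R) (A : set (vec3 R)) :
  (0 < a)%R -> (measurable : set (set (vec3 (measurableTypeR R)))) A ->
  (a ^+ 3)%:E * leb3 R ((fun v : vec3 R => a *: v) @^-1` A) = leb3 R A.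
Proof.
move=> a0 mA; have a1 := ltW a0.
have m1 := measurable_dilation a.
have H1 := fun B => @lebesgue_measure_dilation R a B a0.
have m2 : measurable_fun (setT : set (measurableTypeR R * measurableTypeR R))
    (fun z : measurableTypeR R * measurableTypeR R => ((a * z.1)%R : measurableTypeR R, (a * z.2)%R : measurableTypeR R)).
  by apply: measurable_fun_pair => /=; apply: measurableT_comp.
have H2 := product_measure_dilation m1 m1 a1 a1 H1 H1.
have := @product_measure_dilation _ _ _ _ R (leb2 R) (@lebesgue_measure R)
  _ _ _ _ m2 m1 (mulr_ge0 a1 a1) a1 H2 H1 A mA.
move=> H; rewrite -[RHS]H; congr (_%:E * _).
by rewrite !exprS expr0 mulr1 mulrA.
Qed.

End Dilation.

(** * Real-valued integrals over three-dimensional space *)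

Section AbstractIntegral.
Context d (T : measurableType d) (R : realType) (mu : {measure set T -> \bar R}).
Implicit Types f g : T -> R.

Lemma Rintegral_gt0 f : mu.-integrable setT (EFin \o f) -> (forall v, 0 <= f v) ->
  ~ {ae mu, forall v, f v = 0} -> 0 < \int[mu]_v f v.
Proof.
move=> If f0 nf; rewrite lt_def Rintegral_ge0// andbT; apply/negP => /eqP f00.
apply: nf.
have If0 : (\int[mu]_v `|(f v)%:E| = 0)%E.
  rewrite (eq_integral (fun v => (f v)%:E)); last first.
    by move=> v _; rewrite gee0_abs// lee_fin.
  have := integrable_fin_num measurableT If => /fineK <-.
  by rewrite -[X in X%:E]/(\int[mu]_v f v) f00.
have mf := measurable_int _ If.
have [+ _] := @ae_eq_integral_abs _ _ _ mu _ measurableT _ mf.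
by move=> /(_ If0); apply: filterS => v /= /(_ I) [].
Qed.

Lemma ge0_integrable f : measurable_fun setT f -> (forall v, 0 <= f v) ->
  (\int[mu]_v (f v)%:E < +oo)%E -> mu.-integrable setT (EFin \o f).
Proof.
move=> mf f0 foo; apply/integrableP; split; first exact/measurable_EFinP.
rewrite (eq_integral (fun v => (f v)%:E))//.
by move=> v _ /=; rewrite ger0_norm.
Qed.

(** A signed [f] is the difference of the nonnegative integrable functions
    [`|f| + f] and [`|f|], which reduces the claim to nonnegative functions. *)
Lemma Rintegral_measure_dilation (phi : T -> T) (k : R) f :
  measurable_fun setT phi -> 0 < k ->
  (forall A, measurable A -> k%:E * mu (phi @^-1` A) = mu A)%E ->
  mu.-integrable setT (EFin \o f) ->
  mu.-integrable setT (EFin \o (f \o phi)) /\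
  \int[mu]_v f v = k * \int[mu]_v f (phi v).
Proof.
move=> mphi k0 H.
have ge0_case h : (forall v, 0 <= h v) -> mu.-integrable setT (EFin \o h) ->
    mu.-integrable setT (EFin \o (h \o phi)) /\
    \int[mu]_v h v = k * \int[mu]_v h (phi v).
  move=> h0 Ih; have mh : measurable_fun setT h.
    by apply/measurable_EFinP; exact: measurable_int Ih.
  have E := @ge0_integral_measure_dilation _ _ _ mu phi k (EFin \o h)
    mphi (ltW k0) H (measurable_int _ Ih) h0.
  have Efin := integrable_fin_num measurableT Ih.
  have I2 : mu.-integrable setT (EFin \o (h \o phi)).
    apply: ge0_integrable => [|v|]; [exact: measurableT_comp|exact: h0|].
    rewrite ltey; apply: contraTN Efin => /eqP hoo.
    by rewrite E /= hoo gt0_muley.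
  split=> //; rewrite /Rintegral [X in fine X]E fineM//.
  exact: (integrable_fin_num measurableT I2).
move=> If; have mf : measurable_fun setT f.
  by apply/measurable_EFinP; exact: measurable_int If.
have In : mu.-integrable setT (EFin \o (fun v => `|f v|)).
  exact: (integrable_norm If).
have IS : mu.-integrable setT (EFin \o (fun v => `|f v| + f v)).
  exact: (integrableD measurableT In If).
have [In' En] := ge0_case _ (fun v => normr_ge0 (f v)) In.
have [|IS' ES] := ge0_case _ _ IS.
  by move=> v; rewrite addrC -lerBlDr sub0r lerNnormlW.
have fE v : f v = (`|f v| + f v) - `|f v| by rewrite addrC addKr.
split.
  apply: eq_integrable (integrableB measurableT IS' In') => // v _ /=.
  by rewrite -EFinD -fE.
transitivity (\int[mu]_v ((`|f v| + f v) - `|f v|)).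
  by apply: eq_Rintegral => v _.
rewrite RintegralB// ES En -mulrBr -RintegralB//; congr (_ * _).
by apply: eq_Rintegral => v _; rewrite -fE.
Qed.

(** Dominated convergence for a real parameter.  The sequential theorem applies
    along every sequence tending to [0^'+], truncated at 1 so that the domination
    holds for all of its terms. *)
Lemma cvg_Rintegral_at_right (F : R -> T -> R) f g :
  (forall e, 0 < e -> measurable_fun setT (F e)) ->
  (forall v, F e v @[e --> 0^'+] --> f v) ->
  mu.-integrable setT (EFin \o g) ->
  (forall e v, 0 < e -> e <= 1 -> `|F e v| <= g v) ->
  \int[mu]_v F e v @[e --> 0^'+] --> \int[mu]_v f v.
Proof.
move=> mF Ff Ig Fg; apply/cvg_at_rightP => u [u0 ucvg].
(* the domination is only assumed for parameters at most 1 *)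
pose w n := Num.min (u n) 1.
have w0 n : 0 < w n by rewrite lt_min u0 ltr01.
have w1 n : w n <= 1 by rewrite ge_min lexx orbT.
have wE : \forall n \near \oo, w n = u n.
  have /cvgr_lt/(_ 1 ltr01) := ucvg.
  by apply: filterS => n un1; rewrite /w min_l// ltW.
have wcvg : w n @[n --> \oo] --> 0.
  apply: cvg_trans ucvg; apply: near_eq_cvg.
  by apply: filterS wE => n ->.
apply: (@cvg_trans _ ((fun n => \int[mu]_v F (w n) v) @ \oo)).
  by apply: near_eq_cvg; apply: filterS wE => n ->.
have If : mu.-integrable setT (EFin \o f).
  have cF v : F (w n) v @[n --> \oo] --> f v.
    by have /cvg_at_rightP := Ff v; apply.
  apply: (le_integrable measurableT _ _ Ig).
    apply/measurable_EFinP; apply: (@measurable_fun_cvg _ _ _ setT (fun n => F (w n)) f).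
      by move=> n; exact: mF.
    by move=> v _; exact: cF.
  move=> v _ /=; rewrite lee_fin.
  have cn : `|F (w n) v| @[n --> \oo] --> `|f v| by apply: cvg_norm; exact: cF.
  rewrite -(cvg_lim _ cn)//.
  apply: limr_le; first by apply/cvg_ex; eexists; exact: cn.
  by apply: nearW => n; rewrite (le_trans (Fg _ _ _ _))// ler_norm.
apply: fine_cvg; rewrite fineK; last exact: integrable_fin_num.
apply: (dominated_cvg measurableT _ _ _ Ig) => //.
- by move=> n; apply/measurable_EFinP; exact: mF.
- move=> v _; apply: cvg_EFin; first exact: nearW.
  by have /cvg_at_rightP := Ff v; apply.
- by move=> n v _; rewrite lee_fin; exact: Fg.
Qed.

End AbstractIntegral.

Section RealIntegral.
Context {R : realType}.
Implicit Types (f g : vec3 R -> R) (a k : R).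

Lemma integrable3_dominated f g :
  measurable3 f -> (forall v, `|f v| <= g v) -> integrable3 g -> integrable3 f.
Proof.
move=> mf fg Ig.
apply: (le_integrable measurableT _ _ Ig); first exact/measurable_EFinP.
by move=> v _ /=; rewrite lee_fin (le_trans (fg v))// ler_norm.
Qed.

Lemma integrable3D f g : integrable3 f -> integrable3 g ->
  integrable3 (fun v => f v + g v).
Proof.
by move=> If Ig; exact: (integrableD measurableT If Ig).
Qed.

Lemma integrable3Z k f : integrable3 f -> integrable3 (fun v => k * f v).
Proof. by move=> If; exact: (integrableZl measurableT k If). Qed.

Lemma int3D f g : integrable3 f -> integrable3 g ->
  int3 (fun v => f v + g v) = int3 f + int3 g.
Proof. by move=> If Ig; exact: (RintegralD measurableT If Ig). Qed.

Lemma int3Z k f : integrable3 f -> int3 (fun v => k * f v) = k * int3 f.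
Proof. by move=> If; exact: (RintegralZl k measurableT If). Qed.

Lemma int3_ge0 f : (forall v, 0 <= f v) -> 0 <= int3 f.
Proof. by move=> f0; apply: Rintegral_ge0 => v _; exact: f0. Qed.

Lemma le_int3 f g : integrable3 f -> integrable3 g ->
  (forall v, f v <= g v) -> int3 f <= int3 g.
Proof. by move=> If Ig fg; apply: (le_Rintegral measurableT If Ig). Qed.

Lemma int3_gt0 f : integrable3 f -> (forall v, 0 <= f v) ->
  ~ {ae leb3 R, forall v, f v = 0} -> 0 < int3 f.
Proof.
exact: Rintegral_gt0.
Qed.

Lemma integrable3_ge0 f : measurable3 f -> (forall v, 0 <= f v) ->
  (\int[leb3 R]_v (f v)%:E < +oo)%E -> integrable3 f.
Proof. exact: ge0_integrable. Qed.

Lemma int3_dilation a f : 0 < a -> integrable3 f ->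
  integrable3 (fun v => f (a *: v)) /\
  int3 f = a ^+ 3 * int3 (fun v => f (a *: v)).
Proof.
move=> a0 If.
have mphi : measurable_fun (setT : set (vec3 (measurableTypeR R)))
    (fun v => (a *: (v : vec3 R)) : vec3 (measurableTypeR R)).
  have m1 := measurable_dilation a.
  apply: measurable_fun_pair => /=; last exact: measurableT_comp.
  apply: measurable_fun_pair => /=.
    by apply: (measurableT_comp m1); exact: measurable3_x.
  by apply: (measurableT_comp m1); exact: measurable3_y.
have H := fun A => @leb3_dilation R a A a0.
exact: (Rintegral_measure_dilation mphi (exprn_gt0 3 a0) H If).
Qed.

End RealIntegral.

(** * Product densities and the Gaussian integral *)

Section Tonelli.
Local Open Scope ereal_scope.
Context d1 d2 (T1 : measurableType d1) (T2 : measurableType d2) (R : realType).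
Variables (m1 : {sigma_finite_measure set T1 -> \bar R})
  (m2 : {sigma_finite_measure set T2 -> \bar R}).

Lemma ge0_integral_prod_mul (f : T1 -> R) (g : T2 -> R) :
  measurable_fun setT f -> measurable_fun setT g ->
  (forall x, 0 <= f x)%R -> (forall y, 0 <= g y)%R ->
  \int[m1 \x m2]_z (f z.1 * g z.2)%:E
  = (\int[m1]_x (f x)%:E) * (\int[m2]_y (g y)%:E).
Proof.
move=> mf mg f0 g0.
rewrite (@fubini_tonelli1 _ _ _ _ _ m1 m2 (fun z => (f z.1 * g z.2)%:E)); first last.
- by move=> z; rewrite lee_fin mulr_ge0.
- apply/measurable_EFinP; apply: measurable_realfun.measurable_funM.
    exact: (measurableT_comp mf measurable_fst).
  exact: (measurableT_comp mg measurable_snd).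
rewrite /fubini_F/=.
transitivity (\int[m1]_x ((f x)%:E * \int[m2]_y (g y)%:E)).
  apply: eq_integral => x _.
  rewrite -ge0_integralZl//; first exact/measurable_EFinP.
  - by move=> y _; rewrite lee_fin.
  by rewrite lee_fin.
rewrite ge0_integralZr//; first exact/measurable_EFinP.
  by move=> x _; rewrite lee_fin.
by apply: integral_ge0 => y _; rewrite lee_fin.
Qed.

End Tonelli.

Section ProductDensity.
Context {R : realType}.
Local Notation mu := (@lebesgue_measure R).

(** A function with independent, identical coordinate factors: Tonelli turns the
    integral into a cube. *)
Lemma int3_cube (f : R -> R) (k : R) : continuous f -> (forall x, 0 <= f x) ->
  (\int[mu]_x (f x)%:E = k%:E)%E ->
  let F := fun v : vec3 R => f v.1.1 * f v.1.2 * f v.2 in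
  integrable3 F /\ int3 F = k ^+ 3.
Proof.
move=> cf f0 fk F.
have mf : measurable_fun setT f := continuous_measurable_fun cf.
have mf2 : measurable_fun (setT : set (measurableTypeR R * measurableTypeR R))
    (fun z => f z.1 * f z.2).
  apply: measurable_realfun.measurable_funM.
    exact: (measurableT_comp mf measurable_fst).
  exact: (measurableT_comp mf measurable_snd).
have E2 := @ge0_integral_prod_mul _ _ _ _ _ mu mu f f mf mf f0 f0.
have E3 := @ge0_integral_prod_mul _ _ _ _ _ (leb2 R) mu _ f mf2 mf
  (fun z => mulr_ge0 (f0 z.1) (f0 z.2)) f0.
have E : (\int[leb3 R]_v (F v)%:E = (k ^+ 3)%:E)%E.
  apply: (eq_trans E3); rewrite [X in (X * _)%E](E2) fk.
  by rewrite -!EFinM; congr (_%:E); ring.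
have F0 v : 0 <= F v by rewrite /F !mulr_ge0.
split; last by rewrite /int3 /Rintegral E.
apply: integrable3_ge0 => //; last by rewrite E ltry.
by apply: measurable3M; [apply: measurable3M|]; apply: measurable3_comp => //;
  [exact: measurable3_x|exact: measurable3_y|exact: measurable3_z].
Qed.

Lemma integral_oneDsqrV : (\int[mu]_x ((1 + x ^+ 2)^-1)%:E = pi%:E)%E.
Proof.
have H := @integral0y_oneDsqr R.
rewrite (@ge0_symfun_integralT R (fun x => (oneDsqr x)^-1)).
- rewrite (_ : [set x | _] = `[0, +oo[%classic); last first.
    by apply/seteqP; split => x/=; rewrite in_itv/= andbT.
  by rewrite H -EFinM mulrC divfK.
- by move=> x; rewrite invr_ge0 (le_trans _ (oneDsqr_ge1 x)).
- exact: continuous_oneDsqrV.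
- by move=> x /=; rewrite /oneDsqr sqrrN.
Qed.

(** Dominating function for all relativistic exponentials: these decay
    exponentially in [|v|], too slowly for a Gaussian, but faster than any power. *)
Definition cauchy3 (v : vec3 R) : R :=
  (1 + v.1.1 ^+ 2)^-1 * (1 + v.1.2 ^+ 2)^-1 * (1 + v.2 ^+ 2)^-1.

Lemma integrable3_cauchy : integrable3 cauchy3.
Proof.
have [||//] := @int3_cube (fun x => (1 + x ^+ 2)^-1) pi _ _ integral_oneDsqrV.
- exact: continuous_oneDsqrV.
- by move=> x; rewrite invr_ge0 addr_ge0// sqr_ge0.
Qed.

Lemma dotE (v w : vec3 R) : dot v w = v.1.1 * w.1.1 + v.1.2 * w.1.2 + v.2 * w.2.
Proof. by []. Qed.

Lemma dot_ge0 (v : vec3 R) : 0 <= dot v v.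
Proof. by rewrite dotE -!expr2 !addr_ge0// sqr_ge0. Qed.

Lemma dotZZ (a : R) (v w : vec3 R) : dot (a *: v) (a *: w) = a ^+ 2 * dot v w.
Proof. by rewrite !dotE /=; rewrite /GRing.scale/=; ring. Qed.

Lemma measurable3_dot : measurable3 (fun v : vec3 R => dot v v).
Proof.
by apply: measurable3D; [apply: measurable3D|]; apply: measurable3M;
  [exact: measurable3_x|exact: measurable3_x|exact: measurable3_y
  |exact: measurable3_y|exact: measurable3_z|exact: measurable3_z].
Qed.

Lemma int3_gaussian :
  integrable3 (fun v : vec3 R => expR (- (dot v v / 2))) /\
  int3 (fun v : vec3 R => expR (- (dot v v / 2))) = Num.sqrt (2 * pi) ^+ 3.
Proof.
have [||I E] := @int3_cube gauss_fun (Num.sqrt pi) _ _ (@integralT_gauss R).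
- exact: continuous_gauss_fun.
- exact: gauss_fun_ge0.
set F := (fun v : vec3 R => _) in I E.
have FE : F = fun v => expR (- dot v v).
  apply/funext => v; rewrite /F /gauss_fun -!expRD dotE; congr expR.
  by rewrite !expr2; ring.
rewrite FE in I E.
have s2 : 0 < (Num.sqrt 2)^-1 :> R by rewrite invr_gt0 sqrtr_gt0.
have [I2 E2] := int3_dilation s2 I.
have G (v : vec3 R) : expR (- dot ((Num.sqrt 2)^-1 *: v) ((Num.sqrt 2)^-1 *: v)) = expR (- (dot v v / 2)).
  by rewrite dotZZ exprVn sqr_sqrtr// mulrC.
rewrite (funext G) in I2 E2.
split => //; move: E2; rewrite E sqrtrM// exprMn exprVn => ->.
by rewrite mulrA divff ?mul1r// expf_neq0// gt_eqF// sqrtr_gt0.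
Qed.

End ProductDensity.

(** * Second moment of the Gaussian *)

Section GaussianMoment.
Context {R : realType}.
Implicit Types (v : vec3 R).

Lemma measurable3_expRN (f : vec3 R -> R) : measurable3 f ->
  measurable3 (fun v => expR (- f v)).
Proof.
move=> mf; apply: (@measurable3_comp R (fun x => expR (- x))) => //.
by move=> x; apply: continuous_comp; [exact: opp_continuous|exact: continuous_expR].
Qed.

Lemma measurable3_cst (k : R) : measurable3 (fun=> k).
Proof. exact: measurable_cst. Qed.

Lemma integrable3_gaussian_moment :
  integrable3 (fun v => dot v v / 2 * expR (- (dot v v / 2))).
Proof.
have s2 : 0 < (Num.sqrt 2)^-1 :> R by rewrite invr_gt0 sqrtr_gt0.
have [I _] := @int3_gaussian R.
have [I2 _] := int3_dilation s2 I.
apply: integrable3_dominated (integrable3Z 2 I2).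
  apply: measurable3M.
    by apply: measurable3M; [exact: measurable3_dot|exact: measurable3_cst].
  apply: measurable3_expRN.
  by apply: measurable3M; [exact: measurable3_dot|exact: measurable3_cst].
move=> v; rewrite dotZZ exprVn sqr_sqrtr//.
have := dot_ge0 v; set q := dot v v => q0.
rewrite ger0_norm ?mulr_ge0 ?expR_ge0//.
have -> : q / 2 = 2^-1 * q / 2 + 2^-1 * q / 2 by field.
(* [2 t exp (- 2 t) <= 2 exp (- t)], and the right-hand side is a wider Gaussian *)
set t := 2^-1 * q / 2; have t0 : 0 <= t by rewrite /t; lra.
rewrite opprD expRD mulrA; apply: ler_pM => //; rewrite ?mulr_ge0 ?addr_ge0 ?expR_ge0//.
have := expR_ge1Dx t; rewrite expRN -ler_pdivlMr ?invr_gt0 ?expR_gt0// invrK.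
by have := expR_gt0 t; lra.
Qed.

(** The mean energy of a Gaussian is minus the logarithmic derivative of its mass
    with respect to the inverse temperature [s ^+ 2], and dilation gives that mass
    as a multiple of [s ^- 3].  Differentiation under the integral is replaced by
    the convexity of [exp], which brackets the difference quotient; the two
    bounds meet as [s --> 1]. *)
Lemma int3_gaussian_moment :
  int3 (fun v => dot v v / 2 * expR (- (dot v v / 2)))
  = 3 / 2 * Num.sqrt (2 * pi) ^+ 3.
Proof.
have [I <-] := @int3_gaussian R; have IS := integrable3_gaussian_moment.
set F := int3 (fun v => expR _); set S := int3 _.
have bounds s : 1 < s ->
    F * (s ^+ 2 + s + 1) <= S * (s ^+ 3 * (s + 1)) /\
    S * (s + 1) <= F * (s ^+ 2 * (s ^+ 2 + s + 1)).
  move=> s1; have s0 : 0 < s by rewrite (lt_trans _ s1).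
  have [D1 E1] := int3_dilation s0 I.
  have [D2 E2] := int3_dilation s0 IS.
  have k0 : 0 <= s ^+ 2 - 1 by rewrite subr_ge0 exprn_ege1// ltW.
  set f1 := (fun v => expR _) in I E1 D1 *.
  set f2 := (fun v => _ * _) in IS E2 D2 *.
  have lower v : (s ^+ 2 - 1) * s ^- 2 * f2 (s *: v) <= f1 v - f1 (s *: v).
    rewrite /f1 /f2 dotZZ.
    have -> : s ^+ 2 * dot v v / 2 = s ^+ 2 * (dot v v / 2) by rewrite mulrA.
    set q := dot v v / 2; set e := expR (- (_ * q)).
    have -> : (s ^+ 2 - 1) * s ^- 2 * (s ^+ 2 * q * e) = (s ^+ 2 - 1) * q * e.
      by field; rewrite gt_eqF.
    rewrite {}/e.
    have -> : - q = (s ^+ 2 - 1) * q + - (s ^+ 2 * q) by ring.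
    rewrite expRD -[X in _ <= _ - X]mul1r -mulrBl ler_wpM2r ?expR_ge0//.
    by have := expR_ge1Dx ((s ^+ 2 - 1) * q); lra.
  have upper v : f1 v - f1 (s *: v) <= (s ^+ 2 - 1) * f2 v.
    rewrite /f1 /f2 dotZZ -mulrA; set q := dot v v / 2.
    have -> : - (s ^+ 2 * q) = - ((s ^+ 2 - 1) * q) + - q by ring.
    rewrite [X in _ <= X]mulrA expRD -[X in X - _ <= _]mul1r -mulrBl ler_wpM2r ?expR_ge0//.
    by have := expR_ge1Dx (- ((s ^+ 2 - 1) * q)); lra.
  have If := integrableB measurableT I D1.
  have EB : int3 (fun v => f1 v - f1 (s *: v)) = F * (1 - s ^- 3).
    rewrite (_ : int3 _ = F - int3 (fun v => f1 (s *: v))); last exact: RintegralB.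
    have -> : int3 (fun v => f1 (s *: v)) = F * s ^- 3.
      by rewrite {}/F E1; field; rewrite gt_eqF.
    by rewrite mulrBr mulr1.
  have := le_int3 (integrable3Z ((s ^+ 2 - 1) * s ^- 2) D2) If lower.
  have := le_int3 If (integrable3Z (s ^+ 2 - 1) IS) upper.
  rewrite !int3Z// EB; set S' := int3 (fun v => f2 (s *: v)) in E2 *.
  have -> : S' = S * s ^- 3 by rewrite /S E2; field; rewrite gt_eqF.
  have s1' : 0 < s - 1 by rewrite subr_gt0.
  move=> up lo; split.
  - rewrite -(ler_pM2r s1').
    have -> : F * (s ^+ 2 + s + 1) * (s - 1) = F * (1 - s ^- 3) * s ^+ 3.
      by field; rewrite gt_eqF.
    have -> : S * (s ^+ 3 * (s + 1)) * (s - 1) = (s ^+ 2 - 1) * S * s ^+ 3 by ring.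
    by rewrite ler_pM2r// exprn_gt0.
  - rewrite -(ler_pM2r s1').
    have -> : F * (s ^+ 2 * (s ^+ 2 + s + 1)) * (s - 1) = F * (1 - s ^- 3) * s ^+ 5.
      by field; rewrite gt_eqF.
    have -> : S * (s + 1) * (s - 1)
        = (s ^+ 2 - 1) * s ^- 2 * (S * s ^- 3) * s ^+ 5.
      by field; rewrite gt_eqF.
    by rewrite ler_pM2r// exprn_gt0.
(* the bounds hold for [s > 1] and pass to the limit [s --> 1] from the right *)
have lim1 (p q : R -> R) : continuous p -> continuous q ->
    (forall s, 1 < s -> p s <= q s) -> p 1 <= q 1.
  move=> cp cq pq.
  apply: (@ler_cvg_to _ (1^'+) _ _ p q).
  - exact: cvg_at_right_filter (cp 1).
  - exact: cvg_at_right_filter (cq 1).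
  - by near=> s; apply: pq; near: s; exact: nbhs_right_gt.
have ctsC (k : R) (p : R -> R) : continuous p -> continuous (fun s => k * p s).
  by move=> cp s; apply: cvgM; [exact: cvg_cst|exact: cp].
have ctsM (p q : R -> R) : continuous p -> continuous q -> continuous (fun s => p s * q s).
  by move=> cp cq s; apply: cvgM; [exact: cp|exact: cq].
have ctsD (p q : R -> R) : continuous p -> continuous q -> continuous (fun s => p s + q s).
  by move=> cp cq s; apply: cvgD; [exact: cp|exact: cq].
have ctsX n : continuous (fun s : R => s ^+ n) by exact: exprn_continuous.
have cts1 : continuous (fun s : R => s + 1).
  by apply: (ctsD) => s; [exact: cvg_id|exact: cvg_cst].
have cts2 : continuous (fun s : R => s ^+ 2 + s + 1).
  by apply: (ctsD) => [|s]; [apply: (ctsD) => // s; exact: cvg_id|exact: cvg_cst].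
have H1 := lim1 (fun s => F * (s ^+ 2 + s + 1)) (fun s => S * (s ^+ 3 * (s + 1)))
  (ctsC _ _ cts2) (ctsC _ _ (ctsM _ _ (ctsX 3) cts1))
  (fun s s1 => (bounds s s1).1).
have H2 := lim1 (fun s => S * (s + 1)) (fun s => F * (s ^+ 2 * (s ^+ 2 + s + 1)))
  (ctsC _ _ cts1) (ctsC _ _ (ctsM _ _ (ctsX 2) cts2))
  (fun s s1 => (bounds s s1).2).
rewrite /= !expr1n in H1 H2.
by apply/eqP; rewrite eq_le; lra.
Unshelve. all: by end_near. Qed.
End GaussianMoment.

(** * Lorentz factor and kinetic energy *)

Section LorentzFactor.
Context {R : realType}.
Implicit Types (v : vec3 R) (d e : R).

Lemma gam_sqr e v : gam e v ^+ 2 = 1 + e ^+ 2 * dot v v.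
Proof.
by rewrite sqr_sqrtr dotZZ// addr_ge0// mulr_ge0 ?sqr_ge0 ?dot_ge0.
Qed.

Lemma gam_ge1 e v : 1 <= gam e v.
Proof.
rewrite -[X in X <= _]sqrtr1 ler_wsqrtr// lerDl dotZZ.
by rewrite mulr_ge0 ?sqr_ge0 ?dot_ge0.
Qed.

Lemma gam_gt0 e v : 0 < gam e v.
Proof. exact: lt_le_trans ltr01 (gam_ge1 e v). Qed.

Lemma gam_neq0 e v : gam e v != 0.
Proof. by rewrite gt_eqF ?gam_gt0. Qed.

Lemma gamZ e a v : gam e (a *: v) = gam (e * a) v.
Proof. by rewrite /gam scalerA. Qed.

Lemma le_gam d e v : 0 <= d -> d <= e -> gam d v <= gam e v.
Proof.
move=> d0 de; rewrite ler_wsqrtr// lerD2l !dotZZ ler_wpM2r ?dot_ge0//.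
by rewrite lerXn2r// nnegrE (le_trans d0).
Qed.

Lemma measurable3_gam e : measurable3 (gam e).
Proof.
have -> : gam e = fun v => Num.sqrt (1 + e ^+ 2 * dot v v).
  by apply/funext => v; rewrite /gam dotZZ.
apply: measurable3_comp; first exact: sqrt_continuous.
apply: measurable3D; first exact: measurable3_cst.
by apply: measurable3M; [exact: measurable3_cst|exact: measurable3_dot].
Qed.

Lemma measurable3_gamV e : measurable3 (fun v => (gam e v)^-1).
Proof.
have -> : (fun v => (gam e v)^-1) = fun v => gam e v * (oneDsqr (e * Num.sqrt (dot v v)))^-1.
  apply/funext => v; rewrite /oneDsqr exprMn sqr_sqrtr ?dot_ge0// -gam_sqr.
  by field; exact: gam_neq0.
apply: measurable3M; first exact: measurable3_gam.
apply: (@measurable3_comp R (fun x => (oneDsqr x)^-1)).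
  exact: continuous_oneDsqrV.
apply: measurable3M; first exact: measurable3_cst.
by apply: measurable3_comp; [exact: sqrt_continuous|exact: measurable3_dot].
Qed.

Lemma cvg_gam v : gam e v @[e --> 0^'+] --> (1 : R).
Proof.
have c : (fun e => gam e v) = fun e => Num.sqrt (1 + e ^+ 2 * dot v v).
  by apply/funext => e; rewrite /gam dotZZ.
have c2 : (1 + e ^+ 2 * dot v v) @[e --> (0 : R)] --> 1 + 0 ^+ 2 * dot v v.
  apply: cvgD; first exact: cvg_cst.
  by apply: cvgM; [exact: exprn_continuous|exact: cvg_cst].
have c3 := continuous_cvg _ (@sqrt_continuous R _) c2.
apply: cvg_at_right_filter; rewrite c.
by move: c3; rewrite expr0n/= mul0r addr0 sqrtr1; apply.
Qed.

(** Relativistic kinetic energy of the velocity [v] per unit rest mass, where [1 / d]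
    is the speed of light. *)
Definition kin d v : R := (gam d v - 1) / d ^+ 2.

Lemma gamE d v : d != 0 -> gam d v = 1 + d ^+ 2 * kin d v.
Proof. by move=> d0; rewrite /kin; field. Qed.

(** This form shows the Newtonian limit, and that [kin d v] decreases with [d]. *)
Lemma kinE d v : d != 0 -> kin d v = dot v v / (1 + gam d v).
Proof.
move=> d0; have := gam_sqr d v; have := gam_gt0 d v.
rewrite /kin; set g := gam d v => g0 g2.
apply/eqP; rewrite eqr_div ?sqrf_eq0//; last by rewrite gt_eqF// addr_gt0.
by apply/eqP; transitivity (g ^+ 2 - 1); [ring|rewrite g2; ring].
Qed.

Lemma kin_ge0 d v : 0 <= kin d v.
Proof. by rewrite divr_ge0 ?sqr_ge0// subr_ge0 gam_ge1. Qed.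

Lemma kin_le d v : 0 < d -> kin d v <= dot v v / 2.
Proof.
move=> d0; rewrite kinE ?gt_eqF// ler_wpM2l ?dot_ge0//.
rewrite lef_pV2 ?posrE ?addr_gt0 ?gam_gt0//.
by have := gam_ge1 d v; lra.
Qed.

Lemma le_kin d e v : 0 < d -> d <= e -> kin e v <= kin d v.
Proof.
move=> d0 de; have e0 := lt_le_trans d0 de.
rewrite !kinE ?gt_eqF// ler_wpM2l ?dot_ge0//.
by rewrite lef_pV2 ?posrE ?addr_gt0 ?gam_gt0// lerD2l le_gam// ltW.
Qed.

Lemma cvg_kin v : kin d v @[d --> 0^'+] --> dot v v / 2.
Proof.
apply: (@cvg_trans _ ((fun d => dot v v / (1 + gam d v)) @ 0^'+)).
  by apply: near_eq_cvg; near=> d; rewrite kinE// gt_eqF.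
apply: cvgM; first exact: cvg_cst.
apply: cvgV; first by rewrite pnatr_eq0.
have -> : 2 = 1 + 1 :> R by [].
by apply: cvgD; [exact: cvg_cst|exact: cvg_gam].
Unshelve. all: by end_near. Qed.

Lemma measurable3_kin d : measurable3 (kin d).
Proof.
apply: measurable3M; last exact: measurable3_cst.
by apply: measurable3D; [exact: measurable3_gam|exact: measurable3_cst].
Qed.

End LorentzFactor.

(** * Thermal integrals in the non-relativistic limit *)

Section Thermal.
Context {R : realType}.
Implicit Types (v : vec3 R) (d e x : R).

(** With [g = gam d v], the polynomial [1 + dot v v] is at most a constant times
    [g ^+ 2], the product of the three Cauchy denominators at most a constant times
    [g ^+ 6], and [g ^+ 8] is absorbed by the exponential. *)
Lemma expR_kin_dominated d : 0 < d -> exists K : R, forall v,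
  (1 + dot v v) * expR (- kin d v) <= K * cauchy3 v.
Proof.
move=> d0; have dN0 : d != 0 by rewrite gt_eqF.
pose P := 1 + d ^- 2; pose M := d ^+ 16 * (8`!)%:R * expR (d ^- 2).
exists (P ^+ 4 * M) => v.
have := dot_ge0 v; set q := dot v v => q0.
set g := gam d v; have g0 : 0 < g := gam_gt0 d v.
have q1 : 0 < 1 + q by rewrite ltr_pwDl.
have le1 : 1 + q <= P * g ^+ 2.
  rewrite /P gam_sqr -/q.
  have -> : (1 + d ^- 2) * (1 + d ^+ 2 * q) = 1 + q + (d ^+ 2 * q + d ^- 2) by field.
  by rewrite lerDl addr_ge0 ?mulr_ge0 ?invr_ge0 ?sqr_ge0 ?(ltW d0).
have le2 : g ^+ 8 * expR (- kin d v) <= M.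
  have t0 : 0 <= g / d ^+ 2 by rewrite divr_ge0 ?sqr_ge0// ltW.
  (* the term of degree 8 of the exponential series *)
  have := expR_ge1Dxn 7 t0.
  set X := expR (g / d ^+ 2) => H.
  have f8 : 0 < (8`!)%:R :> R by rewrite ltr0n fact_gt0.
  have H8 : (g / d ^+ 2) ^+ 8 <= (8`!)%:R * X.
    by rewrite [X in _ <= X]mulrC -ler_pdivrMr//; apply: (le_trans _ H); rewrite lerDr.
  have -> : kin d v = g / d ^+ 2 - d ^- 2 by rewrite /kin -/g; field.
  rewrite opprB expRD expRN -/X.
  have -> : M = d ^+ 16 * ((8`!)%:R * X) * (X^-1 * expR (d ^- 2)).
    by rewrite /M; field; rewrite gt_eqF// expR_gt0.
  have -> : g ^+ 8 * (expR (d ^- 2) / X) = d ^+ 16 * (g / d ^+ 2) ^+ 8 * (X^-1 * expR (d ^- 2)).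
    by field; rewrite dN0 gt_eqF// expR_gt0.
  rewrite ler_wpM2r ?mulr_ge0 ?invr_ge0 ?expR_ge0// ler_wpM2l// exprn_ge0//.
  exact: ltW.
have le3 : ((1 + q) ^+ 3)^-1 <= cauchy3 v.
  have q3 : (1 + q) ^+ 3 = (1 + q) * (1 + q) * (1 + q) by ring.
  have s1 : v.1.1 ^+ 2 <= q by rewrite /q dotE -!expr2 -addrA lerDl addr_ge0 ?sqr_ge0.
  have s2 : v.1.2 ^+ 2 <= q by rewrite /q dotE -!expr2 addrAC lerDr addr_ge0 ?sqr_ge0.
  have s3 : v.2 ^+ 2 <= q by rewrite /q dotE -!expr2 lerDr addr_ge0 ?sqr_ge0.
  have pos (z : R) : 0 < 1 + z ^+ 2 by rewrite ltr_pwDl ?sqr_ge0.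
  rewrite /cauchy3 -!invfM lef_pV2 ?posrE ?mulr_gt0 ?exprn_gt0//.
  rewrite q3; apply: ler_pM; last by rewrite lerD2l.
  - by rewrite ltW// mulr_gt0.
  - exact: ltW.
  - by apply: ler_pM; rewrite ?lerD2l// ltW.
have P0 : 0 <= P by rewrite addr_ge0// invr_ge0 sqr_ge0.
have M0 : 0 <= M by rewrite !mulr_ge0 ?expR_ge0// ?exprn_ge0// ltW.
apply: (@le_trans _ _ (P ^+ 4 * M * ((1 + q) ^+ 3)^-1)); last first.
  by rewrite ler_wpM2l// mulr_ge0// exprn_ge0.
rewrite ler_pdivlMr ?exprn_gt0//.
have -> : (1 + q) * expR (- kin d v) * (1 + q) ^+ 3 = (1 + q) ^+ 4 * expR (- kin d v) by ring.
apply: (@le_trans _ _ ((P * g ^+ 2) ^+ 4 * expR (- kin d v))).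
  by rewrite ler_wpM2r ?expR_ge0// lerXn2r// nnegrE ?mulr_ge0 ?sqr_ge0// ltW.
have -> : (P * g ^+ 2) ^+ 4 * expR (- kin d v) = P ^+ 4 * (g ^+ 8 * expR (- kin d v)) by ring.
by rewrite ler_wpM2l// exprn_ge0.
Qed.

(** Total mass of the Maxwell-Juttner weight in the velocity unit that makes
    its thermal width of order 1: [d ^- 2] is the ratio of rest energy to temperature,
    and the factor [exp (- d ^- 2)] has been removed. *)
Definition juttner_mass d : R := int3 (fun v => expR (- kin d v) / gam d v).

Definition juttner_energy d : R :=
  int3 (fun v => kin d v * (expR (- kin d v) / gam d v)).

Lemma measurable3_juttner d : measurable3 (fun v => expR (- kin d v) / gam d v).
Proof.
apply: measurable3M; last exact: measurable3_gamV.
by apply: measurable3_expRN; exact: measurable3_kin.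
Qed.

Lemma juttner_le d v : expR (- kin d v) / gam d v <= expR (- kin d v).
Proof. by rewrite ler_pdivrMr ?gam_gt0// ler_peMr ?expR_ge0// gam_ge1. Qed.

Lemma juttner_ge0 d v : 0 <= expR (- kin d v) / gam d v.
Proof. by rewrite divr_ge0 ?expR_ge0// ltW// gam_gt0. Qed.

(** One function serves for all [d <= e] because the kinetic energy is smallest
    at the largest [d]. *)
Lemma juttner_dominated e : 0 < e -> exists2 g : vec3 R -> R, integrable3 g &
  forall d v, 0 < d -> d <= e -> expR (- kin d v) / gam d v <= g v /\
    kin d v * (expR (- kin d v) / gam d v) <= g v.
Proof.
move=> e0; have [K HK] := expR_kin_dominated e0.
exists (fun v => K * cauchy3 v); first exact: integrable3Z integrable3_cauchy.
move=> d v d0 de; have q0 := dot_ge0 v.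
have le1 : expR (- kin d v) <= expR (- kin e v) by rewrite ler_expR lerN2 le_kin.
split.
  apply: le_trans (HK v); apply: (le_trans (juttner_le d v)).
  by apply: (le_trans le1); rewrite ler_peMl ?expR_ge0// lerDl.
apply: le_trans (HK v); rewrite ler_pM ?kin_ge0 ?juttner_ge0//.
  by apply: (le_trans (kin_le v d0)); lra.
exact: le_trans (juttner_le d v) le1.
Qed.

Lemma integrable3_juttner d : 0 < d ->
  integrable3 (fun v => expR (- kin d v) / gam d v).
Proof.
move=> d0; have [g Ig H] := juttner_dominated d0.
apply: integrable3_dominated Ig; first exact: measurable3_juttner.
by move=> v; rewrite ger0_norm ?juttner_ge0//; have [] := H d v d0 (lexx _).
Qed.

Lemma integrable3_juttner_energy d : 0 < d ->
  integrable3 (fun v => kin d v * (expR (- kin d v) / gam d v)).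
Proof.
move=> d0; have [g Ig H] := juttner_dominated d0.
apply: integrable3_dominated Ig.
  by apply: measurable3M; [exact: measurable3_kin|exact: measurable3_juttner].
move=> v; rewrite ger0_norm ?(mulr_ge0 (kin_ge0 d v) (juttner_ge0 d v))//.
by have [] := H d v d0 (lexx _).
Qed.

Lemma cvg_juttner v :
  expR (- kin d v) / gam d v @[d --> 0^'+] --> expR (- (dot v v / 2)).
Proof.
rewrite -[X in _ --> X]divr1; apply: cvgM.
  apply: continuous_cvg; first exact: continuous_expR.
  by apply: cvgN; exact: cvg_kin.
by apply: cvgV; [exact: oner_neq0|exact: cvg_gam].
Qed.

Lemma cvg_juttner_mass : juttner_mass d @[d --> 0^'+] --> Num.sqrt (2 * pi : R) ^+ 3.
Proof.
have [g Ig H] := juttner_dominated ltr01.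
rewrite -int3_gaussian.2.
apply: (cvg_Rintegral_at_right (mu := leb3 R)) Ig _.
- by move=> d _; exact: measurable3_juttner.
- by move=> v; exact: cvg_juttner.
- move=> d v d0 d1; rewrite ger0_norm ?juttner_ge0//.
  by have [] := H d v d0 d1.
Qed.

Lemma cvg_juttner_energy :
  juttner_energy d @[d --> 0^'+] --> 3 / 2 * Num.sqrt (2 * pi : R) ^+ 3.
Proof.
have [g Ig H] := juttner_dominated ltr01.
rewrite -int3_gaussian_moment.
apply: (cvg_Rintegral_at_right (mu := leb3 R)) Ig _.
- move=> d _.
  by apply: measurable3M; [exact: measurable3_kin|exact: measurable3_juttner].
- by move=> v; apply: cvgM; [exact: cvg_kin|exact: cvg_juttner].
- move=> d v d0 d1; rewrite ger0_norm ?(mulr_ge0 (kin_ge0 d v) (juttner_ge0 d v))//.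
  by have [] := H d v d0 d1.
Qed.

End Thermal.

(** * Positivity of integrals *)

(** A measure with a non-zero integral is not the zero measure. *)
Lemma ae_exists d (T : measurableType d) (R : realType)
    (mu : {measure set T -> \bar R}) (f : T -> R) (P : T -> Prop) :
  mu.-integrable setT (EFin \o f) -> \int[mu]_v f v != 0 ->
  {ae mu, forall v, P v} -> exists v, P v.
Proof.
move=> If f0 aeP; apply: contrapT => nP; move/eqP: f0; apply.
rewrite /Rintegral (ae_eq_integral (cst 0%E)) ?integral0//.
  exact: (measurable_int mu If).
by apply: filterS aeP => v Pv; exfalso; apply: nP; exists v.
Qed.

(** The function [g] only certifies that [mu] is not the zero measure. *)
Lemma Rintegral_gt0_ae d (T : measurableType d) (R : realType)
    (mu : {measure set T -> \bar R}) (f g : T -> R) (Q : T -> Prop) :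
  mu.-integrable setT (EFin \o f) -> (forall v, 0 <= f v) ->
  mu.-integrable setT (EFin \o g) -> \int[mu]_v g v != 0 ->
  {ae mu, forall v, Q v} -> (forall v, Q v -> 0 < f v) ->
  0 < \int[mu]_v f v.
Proof.
move=> If f0 Ig g0 aeQ fQ; apply: Rintegral_gt0 => // aef.
have [v [/fQ + fv0]] : exists v, Q v /\ f v = 0.
  by apply: (ae_exists Ig g0); apply: filterS2 aeQ aef.
by rewrite fv0 ltxx.
Qed.

Section NullSets.
Context {R : realType}.
Implicit Types (u v : vec3 R) (f : vec3 R -> R).

Lemma set1_vec3 u : [set u] = ([set u.1.1] `*` [set u.1.2]) `*` [set u.2].
Proof.
apply/seteqP; split=> [v /= -> //|].
by case: u => [[x y] z] [[a b] c] /= [[-> ->] ->].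
Qed.

Lemma ae_neq u : {ae leb3 R, forall v, v != u}.
Proof.
have m1 (t : R) : measurable ([set t] : set (measurableTypeR R)).
  exact: measurable_set1.
have m2 := measurableX (m1 u.1.1) (m1 u.1.2).
exists [set u]; rewrite set1_vec3; split.
- exact: measurableX m2 (m1 u.2).
- rewrite [LHS](@product_measure1E _ _ _ _ R (leb2 R) (@lebesgue_measure R) _ _ m2 (m1 u.2)).
  by rewrite [X in (_ * X)%E]lebesgue_measure_set1 mule0.
- by rewrite -set1_vec3 => v /= /negP; rewrite negbK => /eqP.
Qed.

Lemma int3_gt0_off u f : integrable3 f -> (forall v, 0 <= f v) ->
  (forall v, v != u -> 0 < f v) -> 0 < int3 f.
Proof.
have [IG EG] := @int3_gaussian R => If f0 fpos.
apply: (Rintegral_gt0_ae If f0 IG _ (ae_neq u) fpos).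
by rewrite [X in X != 0]EG gt_eqF// exprn_gt0// sqrtr_gt0 mulr_gt0// pi_gt0.
Qed.

Lemma dot_gt0 v : v != 0 -> 0 < dot v v.
Proof.
move=> v0; rewrite lt_def dot_ge0 andbT; apply: contra v0.
case: v => [[x y] z]; rewrite dotE /= -!expr2.
by rewrite !paddr_eq0 ?addr_ge0 ?sqr_ge0// !sqrf_eq0 => /andP[/andP[/eqP-> /eqP->] /eqP->].
Qed.

End NullSets.

(** * Mean Lorentz factor at a given coldness *)

Section MeanLorentzFactor.
Context {R : realType}.
Implicit Types (v : vec3 R) (d e x y : R).

Lemma juttner_mass_gt0 d : 0 < d -> 0 < juttner_mass d.
Proof.
move=> d0; apply: (@int3_gt0_off R 0); first exact: integrable3_juttner.
  by move=> v; exact: juttner_ge0.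
by move=> v _; rewrite divr_gt0 ?expR_gt0 ?gam_gt0.
Qed.

Lemma juttner_energy_gt0 d : 0 < d -> 0 < juttner_energy d.
Proof.
move=> d0; apply: (@int3_gt0_off R 0); first exact: integrable3_juttner_energy.
  by move=> v; rewrite mulr_ge0 ?kin_ge0 ?juttner_ge0.
move=> v v0; apply: mulr_gt0; last by rewrite divr_gt0 ?expR_gt0 ?gam_gt0.
rewrite kinE ?gt_eqF//.
by rewrite divr_gt0 ?dot_gt0// addr_gt0 ?gam_gt0.
Qed.

(** The dilation [v = (d / e) u] turns [x (gam e v - 1)] into [kin d u]. *)
Lemma int3_juttner_scaling x e (d := (Num.sqrt x)^-1) : 0 < x -> 0 < e ->
  [/\ integrable3 (fun v => expR (- (x * gam e v)) / gam e v),
      integrable3 (fun v => expR (- (x * gam e v))),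
      int3 (fun v => expR (- (x * gam e v)) / gam e v)
        = (d / e) ^+ 3 * expR (- x) * juttner_mass d &
      int3 (fun v => expR (- (x * gam e v)))
        = (d / e) ^+ 3 * expR (- x)
          * (juttner_mass d + d ^+ 2 * juttner_energy d)].
Proof.
move=> x0 e0; have d0 : 0 < d by rewrite invr_gt0 sqrtr_gt0.
have dN0 : d != 0 by rewrite gt_eqF.
have eN0 : e != 0 by rewrite gt_eqF.
have xE : x = d ^- 2 by rewrite /d exprVn sqr_sqrtr ?invrK// ltW.
have a0 : 0 < e / d by rewrite divr_gt0.
have [I1 E1] := int3_dilation a0 (integrable3_juttner d0).
have [I2 E2] := int3_dilation a0 (integrable3_juttner_energy d0).
have gE v : gam d ((e / d) *: v) = gam e v by rewrite gamZ mulrC divfK.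
have P1 v : expR (- (x * gam e v)) / gam e v = expR (- x) *
    (expR (- kin d ((e / d) *: v)) / gam d ((e / d) *: v)).
  rewrite mulrA -expRD /kin gE xE; congr (expR _ / _); by field.
have P2 v : expR (- (x * gam e v)) =
    expR (- x) * (expR (- kin d ((e / d) *: v)) / gam d ((e / d) *: v))
    + expR (- x) * d ^+ 2 * (kin d ((e / d) *: v) *
       (expR (- kin d ((e / d) *: v)) / gam d ((e / d) *: v))).
  have G := gamE ((e / d) *: v) dN0; rewrite gE in G.
  by rewrite -[LHS](divfK (gam_neq0 e v)) P1 [X in _ * X = _]G; ring.
rewrite (funext P1) (funext P2); split.
- exact: integrable3Z.
- by apply: integrable3D; exact: integrable3Z.
- by rewrite int3Z// [X in _ = _ * X]E1; field; rewrite dN0 eN0.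
- rewrite int3D; [|exact: integrable3Z..].
  rewrite !int3Z// /juttner_mass /juttner_energy E1 E2; field; by rewrite dN0 eN0.
Qed.

(** The ratio of Bessel functions in the equation for the relativistic
    temperature, [x] being the ratio of rest energy to temperature. *)
Definition mean_gam x : R :=
  int3 (fun v => expR (- (x * gam 1 v)))
  / int3 (fun v => expR (- (x * gam 1 v)) / gam 1 v).

(** The second factor is [x] times the mean kinetic energy, which stays bounded
    as [x] grows. *)
Lemma mean_gamE x (d := (Num.sqrt x)^-1) : 0 < x ->
  mean_gam x = 1 + x^-1 * (juttner_energy d / juttner_mass d).
Proof.
move=> x0; have d0 : 0 < d by rewrite invr_gt0 sqrtr_gt0.
have [_ _ E1 E2] := int3_juttner_scaling x0 ltr01.
rewrite /mean_gam E1 E2 -/d.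
have Z0 := juttner_mass_gt0 d0; have x1 := expR_gt0 (- x).
have -> : x^-1 = d ^+ 2 by rewrite exprVn sqr_sqrtr// ltW.
by field; rewrite !gt_eqF.
Qed.

Lemma mean_gam_gt1 x : 0 < x -> 1 < mean_gam x.
Proof.
move=> x0; have d0 : 0 < (Num.sqrt x)^-1 by rewrite invr_gt0 sqrtr_gt0.
rewrite mean_gamE// ltrDl mulr_gt0 ?invr_gt0// divr_gt0//.
  exact: juttner_energy_gt0.
exact: juttner_mass_gt0.
Qed.

(** Chebyshev's inequality: under the weight of parameter [x], the function
    [gam] and the decreasing function [exp (- (y - x) gam)] of it are negatively
    correlated.  Centring [gam] at its mean [r] and the exponential at its value
    at [r] makes the integrand of the covariance pointwise nonpositive. *)
Lemma mean_gam_nonincreasing x y : 0 < x -> x <= y -> mean_gam y <= mean_gam x.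
Proof.
move=> x0 xy; have y0 := lt_le_trans x0 xy.
have [I1 I2 _ _] := int3_juttner_scaling x0 ltr01.
have [J1 J2 _ _] := int3_juttner_scaling y0 ltr01.
have pos z : 0 < z -> 0 < int3 (fun v => expR (- (z * gam 1 v)) / gam 1 v).
  move=> z0; have [I _ _ _] := int3_juttner_scaling z0 ltr01.
  apply: (@int3_gt0_off R 0) => // v; last by rewrite divr_gt0 ?expR_gt0 ?gam_gt0.
  by rewrite divr_ge0 ?expR_ge0// ltW ?gam_gt0.
set r := mean_gam x; pose k := expR (- ((y - x) * r)).
(* the integrated form of [(gam - r) * (exp (- (y - x) gam) - k) <= 0] *)
have H v : expR (- (y * gam 1 v)) + k * r * (expR (- (x * gam 1 v)) / gam 1 v)
   <= r * (expR (- (y * gam 1 v)) / gam 1 v) + k * expR (- (x * gam 1 v)).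
  set g := gam 1 v; have g0 : 0 < g := gam_gt0 1 v.
  have -> : expR (- (y * g)) = expR (- ((y - x) * g)) * expR (- (x * g)).
    by rewrite -expRD; congr expR; ring.
  set E := expR (- (x * g)); set l := expR (- ((y - x) * g)).
  have E0 : 0 < E := expR_gt0 _.
  rewrite -subr_ge0.
  have -> : r * (l * E / g) + k * E - (l * E + k * r * (E / g))
      = (g - r) * (k - l) * (E / g) by field; rewrite gt_eqF.
  apply: mulr_ge0; last by rewrite divr_ge0// ltW.
  have [gr|rg] := leP g r.
    rewrite mulr_le0 ?subr_le0// ler_expR lerN2 ler_wpM2l// subr_ge0//.
  apply: mulr_ge0; first by rewrite subr_ge0 ltW.
  by rewrite subr_ge0 ler_expR lerN2 ler_wpM2l ?subr_ge0// ltW.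
have := le_int3 _ _ H.
rewrite !int3D ?int3Z//; [|exact: integrable3Z..].
move=> /(_ (integrable3D J2 (integrable3Z _ I1)) (integrable3D (integrable3Z _ J1) (integrable3Z _ I2))).
have Hx := pos x x0; have Hy := pos y y0.
have -> : int3 (fun v => expR (- (x * gam 1 v))) = r * int3 (fun v => expR (- (x * gam 1 v)) / gam 1 v).
  by rewrite /r /mean_gam divfK// gt_eqF.
rewrite mulrA lerD2r => K.
by rewrite {1}/mean_gam ler_pdivrMr.
Qed.

(** Equipartition: three degrees of freedom, each with energy one half. *)
Lemma cvg_thermal_ratio :
  juttner_energy d / juttner_mass d @[d --> 0^'+] --> (3 / 2 : R).
Proof.
have F0 : Num.sqrt (2 * pi : R) ^+ 3 != 0.
  by rewrite gt_eqF// exprn_gt0// sqrtr_gt0 mulr_gt0// pi_gt0.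
rewrite -[X in _ --> X](mulfK F0).
apply: cvgM; first exact: cvg_juttner_energy.
by apply: cvgV => //; exact: cvg_juttner_mass.
Qed.

End MeanLorentzFactor.

(** * Moments of a distribution in the Newtonian limit *)

Section Moments.
Context {R : realType}.
Implicit Types (u v : vec3 R) (e c m mu : R) (f : vec3 R -> R).

Lemma integrable3_gam e f : integrable3 f -> integrable3 (fun v => f v / gam e v).
Proof.
move=> If; apply: (@integrable3_dominated R _ (fun v => `|f v|)).
- by apply: measurable3M; [exact: integrable3_measurable|exact: measurable3_gamV].
- move=> v; rewrite normrM ler_piMr// normfV (gtr0_norm (gam_gt0 e v)).
  by rewrite invf_le1 ?gam_gt0 ?gam_ge1.
- exact: (integrable_norm If).
Qed.

Lemma cvg_int3_gam f : integrable3 f ->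
  int3 (fun v => f v / gam e v) @[e --> 0^'+] --> int3 f.
Proof.
move=> If; apply: (cvg_Rintegral_at_right (mu := leb3 R) (g := fun v => `|f v|)).
- move=> e _.
  by apply: measurable3M; [exact: integrable3_measurable|exact: measurable3_gamV].
- move=> v; rewrite -[X in _ --> X]divr1; apply: cvgM; first exact: cvg_cst.
  by apply: cvgV; [exact: oner_neq0|exact: cvg_gam].
- exact: (integrable_norm If).
- move=> e v _ _; rewrite normrM ler_piMr// normfV (gtr0_norm (gam_gt0 e v)).
  by rewrite invf_le1 ?gam_gt0 ?gam_ge1.
Qed.

(** [(1 - 1 / gam e v) / e ^+ 2 = kin e v / gam e v], which is at most its limit
    [dot v v / 2]. *)
Lemma cvg_int3_gam_defect f : (forall v, 0 <= f v) -> integrable3 f ->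
  integrable3 (fun v => dot v v * f v) ->
  (int3 f - int3 (fun v => f v / gam e v)) / e ^+ 2 @[e --> 0^'+]
    --> int3 (fun v => dot v v * f v) / 2.
Proof.
move=> f0 If Iq; have mf := integrable3_measurable If.
have Iq2 := integrable3Z 2^-1 Iq.
have bound e v : 0 < e -> 0 <= f v * (kin e v / gam e v) <= 2^-1 * (dot v v * f v).
  move=> e0; have k0 : 0 <= kin e v / gam e v by rewrite divr_ge0 ?kin_ge0// ltW ?gam_gt0.
  have -> : 2^-1 * (dot v v * f v) = f v * (dot v v / 2) by ring.
  rewrite mulr_ge0//= ler_wpM2l//.
  apply: (@le_trans _ _ (kin e v)); last exact: kin_le.
  by rewrite ler_pdivrMr ?gam_gt0// ler_peMr ?kin_ge0 ?gam_ge1.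
have mF e : measurable3 (fun v => f v * (kin e v / gam e v)).
  apply: measurable3M => //.
  by apply: measurable3M; [exact: measurable3_kin|exact: measurable3_gamV].
have dom e v : 0 < e -> `|f v * (kin e v / gam e v)| <= 2^-1 * (dot v v * f v).
  by move=> e0; have /andP[h0 h1] := bound e v e0; rewrite ger0_norm.
have IF e : 0 < e -> integrable3 (fun v => f v * (kin e v / gam e v)).
  by move=> e0; apply: integrable3_dominated Iq2 => // v; exact: dom.
apply: (@cvg_trans _ ((fun e => int3 (fun v => f v * (kin e v / gam e v))) @ 0^'+)).
  apply: near_eq_cvg; near=> e.
  have e0 : 0 < e by [].
  have -> : int3 f = int3 (fun v => f v / gam e v)
      + e ^+ 2 * int3 (fun v => f v * (kin e v / gam e v)).
    rewrite -int3Z; last exact: IF.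
    rewrite -int3D; [|exact: integrable3_gam|by apply: integrable3Z; exact: IF].
    congr int3; apply/funext => v; have G := gam_neq0 e v.
    by rewrite /kin; field; rewrite G gt_eqF.
  by field; rewrite gt_eqF.
rewrite mulrC -int3Z//.
apply: (cvg_Rintegral_at_right (mu := leb3 R)) Iq2 _; first by move=> e _; exact: mF.
  move=> v.
  have -> : 2^-1 * (dot v v * f v) = f v * ((dot v v / 2) / 1) by rewrite divr1; ring.
  apply: cvgM; first exact: cvg_cst.
  apply: cvgM; first exact: cvg_kin.
  by apply: cvgV; [exact: oner_neq0|exact: cvg_gam].
by move=> e v e0 _; exact: dom.
Unshelve. all: by end_near. Qed.

Definition flux e f : vec3 R := vint3 (fun v => (f v / gam e v) *: v).

Lemma u_nrE f : n_nr f != 0 ->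
  [/\ int3 (fun v => v.1.1 * f v) = n_nr f * (u_nr f).1.1,
      int3 (fun v => v.1.2 * f v) = n_nr f * (u_nr f).1.2 &
      int3 (fun v => v.2 * f v) = n_nr f * (u_nr f).2].
Proof.
move=> n0; rewrite /u_nr /vint3 /=.
split; rewrite mulrA divff// mul1r; congr int3; apply/funext => v; exact: mulrC.
Qed.

Lemma fluxE e f :
  [/\ (flux e f).1.1 = int3 (fun v => v.1.1 * f v / gam e v),
      (flux e f).1.2 = int3 (fun v => v.1.2 * f v / gam e v) &
      (flux e f).2 = int3 (fun v => v.2 * f v / gam e v)].
Proof.
have F (a b g : R) : b / g * a = a * b / g by ring.
by split; congr int3; apply/funext => v; exact: F.
Qed.

Lemma dotB v u : dot (v - u) (v - u) = dot v v - 2 * dot u v + dot u u.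
Proof. by rewrite !dotE/=; ring. Qed.

(** Koenig's decomposition: energy about the mean velocity plus energy of the mean
    motion.  Finiteness of the centred second moment gives that of the moment
    about the origin. *)
Lemma second_moment f : finite_moments f -> n_nr f != 0 ->
  integrable3 (fun v => dot v v * f v) /\
  int3 (fun v => dot v v * f v)
  = int3 (fun v => dot (v - u_nr f) (v - u_nr f) * f v)
    + n_nr f * dot (u_nr f) (u_nr f).
Proof.
move=> [If I1 I2 I3 ID] n0; have [E1 E2 E3] := u_nrE n0.
set u := u_nr f in ID E1 E2 E3 *.
have J1 := integrable3Z (2 * u.1.1) I1.
have J2 := integrable3Z (2 * u.1.2) I2.
have J3 := integrable3Z (2 * u.2) I3.
have J0 := integrable3Z (- dot u u) If.
have J01 := integrable3D J0 J1.
have J23 := integrable3D J2 J3.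
have J := integrable3D J01 J23.
have F v : dot v v * f v = dot (v - u) (v - u) * f v +
    ((- dot u u * f v + 2 * u.1.1 * (v.1.1 * f v)) +
     (2 * u.1.2 * (v.1.2 * f v) + 2 * u.2 * (v.2 * f v))).
  by rewrite dotB (dotE u v); ring.
rewrite (funext F); split; first exact: integrable3D.
rewrite int3D// (int3D J01 J23) (int3D J0 J1) (int3D J2 J3) !int3Z// E1 E2 E3.
by rewrite (dotE u u) -/(n_nr f); ring.
Qed.

Lemma T_nrE m f : finite_moments f -> n_nr f != 0 ->
  m * n_nr f * dot (u_nr f) (u_nr f) + 3 * n_nr f * T_nr m f
  = m * int3 (fun v => dot v v * f v).
Proof.
move=> fm n0; have [_ ->] := second_moment fm n0.
by rewrite /T_nr; field.
Qed.

Lemma n_nr_gt0 f : integrable3 f -> (forall v, 0 <= f v) ->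
  ~ {ae leb3 R, forall v, f v = 0} -> 0 < n_nr f.
Proof. exact: int3_gt0. Qed.

End Moments.

(** * Passage to dimensionless variables *)

Section Scaling.
Context {R : realType}.
Implicit Types (u v p : vec3 R) (e c m mu b Nd : R) (f : vec3 R -> R).

Lemma int3_dimensional Nd mu f : 0 < mu -> integrable3 f ->
  integrable3 (dimensional Nd mu f) /\
  int3 (dimensional Nd mu f) = Nd * int3 f.
Proof.
move=> mu0 If; have muV : 0 < mu^-1 by rewrite invr_gt0.
have [I E] := int3_dilation muV If.
split; first exact: integrable3Z.
rewrite /dimensional int3Z// E; field; by rewrite gt_eqF.
Qed.

(** The momentum unit [m c e] belongs to velocities measured in units of [e] times
    the speed of light; both [e = 1] and [e = L / (c * s)] are useful. *)
Lemma p0E c m e p : 0 < c -> 0 < m -> 0 < e ->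
  p0 c m p = c * m * gam e ((m * c * e)^-1 *: p).
Proof.
move=> c0 m0 e0; rewrite gamZ /gam dotZZ /p0.
have cm0 : 0 <= c * m by rewrite mulr_ge0 ?ltW.
have -> : (c * m) ^+ 2 + dot p p
    = (c * m) ^+ 2 * (1 + (e * (m * c * e)^-1) ^+ 2 * dot p p).
  by field; rewrite !gt_eqF.
by rewrite sqrtrM ?sqr_ge0// sqrtr_sqr ger0_norm.
Qed.

(** The dilation [p = (m c) w] removes the dimensions. *)
Lemma mean_momentum c m b : 0 < c -> 0 < m -> 0 < b ->
  int3 (fun p => expR (- (c * b * p0 c m p)))
    / int3 (fun p => expR (- (c * b * p0 c m p)) / p0 c m p)
  = c * m * mean_gam (m * (c ^+ 2 * b)).
Proof.
move=> c0 m0 b0.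
have x0 : 0 < m * (c ^+ 2 * b) by rewrite !mulr_gt0 ?exprn_gt0.
have a0 : 0 < (m * c * 1)^-1 by rewrite invr_gt0 !mulr_gt0.
have [I1 I2 _ _] := int3_juttner_scaling x0 ltr01.
have [J1 F1] := int3_dilation a0 I1.
have [J2 F2] := int3_dilation a0 I2.
have cm0 : c * m != 0 by rewrite gt_eqF ?mulr_gt0.
have G1 p : expR (- (c * b * p0 c m p))
    = expR (- (m * (c ^+ 2 * b) * gam 1 ((m * c * 1)^-1 *: p))).
  by rewrite (p0E p c0 m0 ltr01); congr expR; ring.
have G2 p : expR (- (c * b * p0 c m p)) / p0 c m p = (c * m)^-1 *
    (expR (- (m * (c ^+ 2 * b) * gam 1 ((m * c * 1)^-1 *: p)))
      / gam 1 ((m * c * 1)^-1 *: p)).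
  by rewrite G1 (p0E p c0 m0 ltr01); field; rewrite gam_neq0 !gt_eqF.
rewrite (funext G1) (funext G2) int3Z// /mean_gam F1 F2.
set X := int3 _; set Y := int3 _.
have a3 : (m * c * 1)^-1 ^+ 3 != 0 by rewrite expf_neq0// gt_eqF.
by rewrite -mulf_div divff// mul1r [in RHS]mulrC invfM invrK mulrA mulrAC.
Qed.

Lemma density_over_energy c m e Nd f : 0 < c -> 0 < m -> 0 < e ->
  integrable3 f ->
  int3 (fun p => dimensional Nd (m * c * e) f p / p0 c m p)
  = Nd / (c * m) * int3 (fun v => f v / gam e v).
Proof.
move=> c0 m0 e0 If.
have mu0 : 0 < m * c * e by rewrite !mulr_gt0.
have [I E] := int3_dimensional Nd mu0 (integrable3_gam e If).
have F p : dimensional Nd (m * c * e) f p / p0 c m p = (c * m)^-1 *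
    dimensional Nd (m * c * e) (fun v => f v / gam e v) p.
  rewrite (p0E p c0 m0 e0) /dimensional.
  by field; rewrite gam_neq0 !gt_eqF.
by rewrite (funext F) int3Z// E; ring.
Qed.

Lemma currentE c m e Nd f : 0 < c -> 0 < m -> 0 < e -> finite_moments f ->
  current c m (dimensional Nd (m * c * e) f)
  = (c * Nd) *: (n_nr f, e *: flux e f).
Proof.
move=> c0 m0 e0 [If I1 I2 I3 _].
have mu0 : 0 < m * c * e by rewrite !mulr_gt0.
have component h : integrable3 (fun v => h v * f v) -> (forall a v, h (a *: v) = a * h v) ->
    int3 (fun p => dimensional Nd (m * c * e) f p / p0 c m p * h p)
    = Nd * (e * int3 (fun v => h v * f v / gam e v)).
  move=> Ih hZ.
  have [I E] := int3_dimensional Nd mu0 (integrable3_gam e Ih).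
  have F p : dimensional Nd (m * c * e) f p / p0 c m p * h p = e *
      dimensional Nd (m * c * e) (fun v => h v * f v / gam e v) p.
    rewrite (p0E p c0 m0 e0) /dimensional hZ.
    field; by rewrite gam_neq0 !gt_eqF.
  by rewrite (funext F) int3Z// E; ring.
have [F1 F2 F3] := fluxE e f.
have C1 := component (fun v => v.1.1) I1 (fun _ _ => erefl).
have C2 := component (fun v => v.1.2) I2 (fun _ _ => erefl).
have C3 := component (fun v => v.2) I3 (fun _ _ => erefl).
rewrite /current.
have -> : int3 (fun p => p0 c m p * dimensional Nd (m * c * e) f p / p0 c m p)
    = Nd * n_nr f.
  rewrite -(int3_dimensional Nd mu0 If).2; congr int3; apply/funext => p.
  rewrite mulrAC divff ?mul1r// (p0E p c0 m0 e0).
  by rewrite gt_eqF// !mulr_gt0// gam_gt0.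
have -> : vint3 (fun p => (dimensional Nd (m * c * e) f p / p0 c m p) *: p)
    = Nd *: (e *: flux e f).
  rewrite [flux e f]surjective_pairing [(flux e f).1]surjective_pairing F1 F2 F3.
  by congr (_, _, _); [exact: C1|exact: C2|exact: C3].
by rewrite -[RHS]scalerA.
Qed.

End Scaling.

(** * Conservation equations of the mixture *)

Section VectorSums.
Context {R : realType}.

Lemma sum_pair (N : nat) (U V : nmodType) (a : 'I_N -> U) (b : 'I_N -> V) :
  \sum_(i < N) ((a i, b i) : U * V) = (\sum_(i < N) a i, \sum_(i < N) b i).
Proof. by elim/big_rec3: _ => //= i x y z _ ->. Qed.

Lemma sum_vec3 (N : nat) (b : 'I_N -> vec3 R) :
  \sum_(i < N) b i =
  (\sum_(i < N) (b i).1.1, \sum_(i < N) (b i).1.2, \sum_(i < N) (b i).2).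
Proof.
rewrite -!sum_pair; apply: eq_bigr => i _.
by case: (b i) => [[]].
Qed.

Lemma minkowskiZ (k : R) (a : R) (b : vec3 R) :
  Defs.minkowski (k *: ((a, b) : vec4 R)) (k *: ((a, b) : vec4 R))
  = k ^+ 2 * (a ^+ 2 - dot b b).
Proof. by rewrite /Defs.minkowski /= dotZZ /GRing.scale/=; ring. Qed.

Lemma cvg_sum_ord (N : nat) (T : Type) (F : set_system T) (FF : Filter F)
    (g : 'I_N -> T -> R) (l : 'I_N -> R) :
  (forall i, g i x @[x --> F] --> l i) ->
  \sum_(i < N) g i x @[x --> F] --> \sum_(i < N) l i.
Proof.
by move=> gl; apply: cvg_big => //; exact: add_continuous.
Qed.

End VectorSums.

Section Mixture.
Context {R : realType} {N : nat}.
Variables (c : R) (m nu : 'I_N -> R) (f : 'I_N -> vec3 R -> R).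
Hypotheses (c_gt0 : 0 < c) (m_gt0 : forall i, 0 < m i).

Definition mass_density : R := \sum_(i < N) nu i * m i * n_nr (f i).

Definition mix_flux (e : R) : vec3 R := \sum_(i < N) (nu i * m i) *: flux e (f i).

(** Minkowski length of the total weighted particle flux
    [(mass_density, e *: mix_flux e)]. *)
Definition mix_norm (e : R) : R :=
  Num.sqrt (mass_density ^+ 2 - e ^+ 2 * dot (mix_flux e) (mix_flux e)).

Hypothesis fm : forall i, finite_moments (f i).

(** Apart from [e], the units enter both sides through the common factor [Nd / s]. *)
Lemma betat_equation (s L Nd e b : R) (tau : 'I_N -> R) :
  0 < s -> 0 < Nd -> 0 < e -> e = L / (c * s) ->
  (forall i, 0 < tau i /\ nu i = s / tau i) ->
  betat_solution c m tau (fun i => dimensional Nd (m i * L / s) (f i)) b ->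
  0 < b /\
  \sum_(i < N) nu i * m i * mean_gam (m i * (c ^+ 2 * b))
      * int3 (fun v => f i v / gam e v) = mix_norm e.
Proof.
move=> s0 N0 e0 eE taus [b0 H]; split => //.
(* the momentum unit in terms of [e], so that [p0E] applies with that [e] *)
have muE i : m i * L / s = m i * c * e by rewrite eE; field; rewrite !gt_eqF.
have tauE i : m i / tau i = s^-1 * (nu i * m i).
  have [t0 ->] := taus i; by field; rewrite !gt_eqF.
have VE : \sum_(i < N) (m i / tau i) *: current c (m i) (dimensional Nd (m i * L / s) (f i))
    = (s^-1 * (c * Nd)) *: ((mass_density, e *: mix_flux e) : vec4 R).
  rewrite (_ : (mass_density, e *: mix_flux e) = \sum_(i < N) ((nu i * m i * n_nr (f i), e *: ((nu i * m i) *: flux e (f i))) : vec4 R)); last first.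
    by rewrite sum_pair /mix_flux scaler_sumr.
  rewrite scaler_sumr; apply: eq_bigr => i _.
  rewrite muE (currentE Nd c_gt0 (m_gt0 i) e0 (fm i)) tauE scalerA.
  have -> : s^-1 * (nu i * m i) * (c * Nd) = s^-1 * (c * Nd) * (nu i * m i) by ring.
  rewrite -(scalerA (s^-1 * (c * Nd))); congr (_ *: _).
  have -> : e *: ((nu i * m i) *: flux e (f i)) = (nu i * m i) *: (e *: flux e (f i)).
    by rewrite !scalerA mulrC.
  by [].
move: H; rewrite VE minkowskiZ sqrtrM ?sqr_ge0// sqrtr_sqr gtr0_norm; last first.
  by rewrite !mulr_gt0 ?invr_gt0.
rewrite dotZZ -/(mix_norm e) => H.
have k0 : s^-1 * Nd != 0 by rewrite gt_eqF// mulr_gt0 ?invr_gt0.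
apply: (mulfI k0).
have -> : s^-1 * Nd * mix_norm e = c^-1 * (s^-1 * (c * Nd) * mix_norm e).
  by field; rewrite !gt_eqF.
rewrite -H mulr_sumr; apply: eq_bigr => i _.
have [If _ _ _ _] := fm i.
rewrite tauE mean_momentum// muE density_over_energy//.
by field; rewrite !gt_eqF.
Qed.

Lemma UbarE (s e : R) (tau : 'I_N -> R) :
  0 < s -> (forall i, 0 < tau i /\ nu i = s / tau i) ->
  Ubar m tau f e = (mix_norm e)^-1 *: ((mass_density, e *: mix_flux e) : vec4 R).
Proof.
move=> s0 taus.
have tauE i : m i / tau i = s^-1 * (nu i * m i).
  have [t0 ->] := taus i; by field; rewrite !gt_eqF.
rewrite /Ubar.
have -> : \sum_(i < N) m i / tau i * int3 (f i) = s^-1 * mass_density.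
  by rewrite /mass_density mulr_sumr; apply: eq_bigr => i _; rewrite tauE -[LHS]mulrA.
have -> : \sum_(i < N) (m i / tau i) *: (e *: vint3 (fun v => (f i v / gam e v) *: v))
    = s^-1 *: (e *: mix_flux e).
  rewrite /mix_flux !scaler_sumr; apply: eq_bigr => i _.
  by rewrite tauE !scalerA; congr (_ *: _); ring.
rewrite dotZZ exprMn -mulrBr sqrtrM ?sqr_ge0// sqrtr_sqr gtr0_norm ?invr_gt0//.
rewrite dotZZ -/(mix_norm e).
have -> : (s^-1 * mass_density, s^-1 *: (e *: mix_flux e))
   = s^-1 *: ((mass_density, e *: mix_flux e) : vec4 R) by [].
by rewrite scalerA invfM invrK mulrAC divff ?mul1r// gt_eqF.
Qed.

End Mixture.

(** * Temperature and Newtonian limit of the mixture *)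

Lemma ae_mono2 d (T : measurableType d) (R : realType)
    (mu : {measure set T -> \bar R}) (P1 P2 P3 : T -> Prop) :
  (forall x, P1 x -> P2 x -> P3 x) ->
  {ae mu, forall x, P1 x} -> {ae mu, forall x, P2 x} -> {ae mu, forall x, P3 x}.
Proof. by move=> P aeP1 aeP2; apply: filterS2 P aeP1 aeP2. Qed.

Lemma dotZl (R : realType) (a : R) (v w : vec3 R) : dot (a *: v) w = a * dot v w.
Proof. by rewrite !dotE /= /GRing.scale/=; ring. Qed.

Lemma dot_suml (R : realType) (N : nat) (a : 'I_N -> R) (u : 'I_N -> vec3 R) (w : vec3 R) :
  dot (\sum_(i < N) a i *: u i) w = \sum_(i < N) a i * dot (u i) w.
Proof.
elim/big_rec2: _ => [|i x y _ <-]; first by rewrite dotE /=; ring.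
by rewrite !dotE /= /GRing.scale/=; ring.
Qed.

Lemma cvg_id0 (R : realType) : (e : R) @[e --> 0^'+] --> (0 : R).
Proof. exact: cvg_at_right_filter cvg_id. Qed.

Section MixtureLimits.
Context {R : realType} {N : nat}.
Variables (m nu : 'I_N -> R) (f : 'I_N -> vec3 R -> R).
Hypotheses (m_gt0 : forall i, 0 < m i) (nu_gt0 : forall i, 0 < nu i).
Hypothesis f_ge0 : forall i v, 0 <= f i v.
Hypothesis fm : forall i, finite_moments (f i).
Hypothesis f_neq0 : forall i, ~ {ae leb3 R, forall v, f i v = 0}.
Variable i0 : 'I_N.

Let n i := n_nr (f i).
Let A := mass_density m nu f.
Let U := mix_U nu m f.
Let Q := mix_flux m nu f.
Let S := mix_norm m nu f.
Let J i e := int3 (fun v => f i v / gam e v).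
Let T := mix_T nu m f.

Lemma mix_n_gt0 i : 0 < n i.
Proof. by have [If _ _ _ _] := fm i; exact: n_nr_gt0. Qed.

Lemma mix_sum_gt0 (a : 'I_N -> R) : (forall i, 0 < a i) -> 0 < \sum_(i < N) a i.
Proof.
by move=> a0; rewrite (bigD1 i0)//= ltr_pwDl// sumr_ge0// => i _; rewrite ltW.
Qed.

Lemma mass_density_gt0 : 0 < A.
Proof. by apply: mix_sum_gt0 => i; rewrite !mulr_gt0// mix_n_gt0. Qed.

Lemma mix_momentum : A *: U = \sum_(i < N) (nu i * m i * n i) *: u_nr (f i).
Proof. by rewrite /U /mix_U scalerA divff ?scale1r// gt_eqF ?mass_density_gt0. Qed.

Lemma T_nr_gt0 i : 0 < T_nr (m i) (f i).
Proof.
have [If _ _ _ ID] := fm i; have n0 := mix_n_gt0 i.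
rewrite /T_nr mulr_gt0 ?divr_gt0 ?mulr_gt0//.
apply: int3_gt0 => //; first by move=> v; rewrite mulr_ge0 ?dot_ge0.
move=> ae0; apply: (f_neq0 (i := i)).
apply: ae_mono2 (ae_neq (u_nr (f i))) ae0 => v vu /eqP.
by rewrite mulf_eq0 gt_eqF ?dot_gt0 ?subr_eq0//= => /eqP.
Qed.

(** [U] is the mean of the [u_nr (f i)] with weights [nu i * m i * n i], so the
    defect of squares in the definition of [T] is the variance of these velocities. *)
Lemma mix_T_variance : 3 / 2 * (\sum_(i < N) nu i * n i) * T
  = \sum_(i < N) nu i * (2^-1 * m i * n i * dot (u_nr (f i) - U) (u_nr (f i) - U)
                         + 3 / 2 * n i * T_nr (m i) (f i)).
Proof.
have n0 : 3 / 2 * \sum_(i < N) nu i * n i != 0.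
  by rewrite gt_eqF// mulr_gt0// mix_sum_gt0// => i; rewrite mulr_gt0// mix_n_gt0.
rewrite /T /mix_T -/U mulrC divfK//; apply/eqP; rewrite -subr_eq0 -sumrB; apply/eqP.
transitivity (\sum_(i < N) (nu i * m i * n i * dot (u_nr (f i)) U - nu i * m i * n i * dot U U)).
  by apply: eq_bigr => i _; rewrite -/(n i) dotB !dotE; field.
rewrite sumrB -dot_suml -mix_momentum -mulr_suml -/A.
by rewrite dotZl subrr.
Qed.

Lemma mix_T_gt0 : 0 < T.
Proof.
have n0 : 0 < 3 / 2 * \sum_(i < N) nu i * n i.
  by rewrite mulr_gt0// mix_sum_gt0// => i; rewrite mulr_gt0// mix_n_gt0.
rewrite -(pmulr_rgt0 _ n0) mix_T_variance; apply: mix_sum_gt0 => i.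
have ni := mix_n_gt0 i; rewrite mulr_gt0// ltr_wpDl//.
  by rewrite mulr_ge0 ?dot_ge0// ltW// !mulr_gt0.
by apply: mulr_gt0; [apply: mulr_gt0|exact: T_nr_gt0].
Qed.

(** By [T_nrE], internal energy and energy of the mean motion of a species add up to
    its second moment about the origin, which is what the expansion of [gam]
    produces. *)
Lemma mix_T_energy : 3 / 2 * (\sum_(i < N) nu i * n i) * T
  = \sum_(i < N) nu i * m i * (int3 (fun v => dot v v * f i v) / 2)
    - A * dot U U / 2.
Proof.
have n0 : 3 / 2 * \sum_(i < N) nu i * n i != 0.
  by rewrite gt_eqF// mulr_gt0// mix_sum_gt0// => i; rewrite mulr_gt0// mix_n_gt0.
rewrite /T /mix_T -/U mulrC divfK// /A /mass_density -mulrA mulr_suml -sumrB.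
apply: eq_bigr => i _; have ni : n i != 0 by rewrite gt_eqF ?mix_n_gt0.
have := T_nrE (m i) (fm i) ni; rewrite -/(n i) => H.
transitivity (nu i * ((m i * n i * dot (u_nr (f i)) (u_nr (f i)) + 3 * n i * T_nr (m i) (f i)) / 2
  - m i * n i * dot U U / 2)); first by field.
by rewrite H; field.
Qed.

Lemma cvg_mix_flux : [/\ (Q e).1.1 @[e --> 0^'+] --> A * U.1.1,
  (Q e).1.2 @[e --> 0^'+] --> A * U.1.2 & (Q e).2 @[e --> 0^'+] --> A * U.2].
Proof.
have component (k : vec3 R -> R) :
    (forall a v, k (a *: v) = a * k v) ->
    (forall b : 'I_N -> vec3 R, k (\sum_(i < N) b i) = \sum_(i < N) k (b i)) ->
    (forall i, [/\ integrable3 (fun v => k v * f i v),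
       int3 (fun v => k v * f i v) = n i * k (u_nr (f i)) &
       forall e, k (flux e (f i)) = int3 (fun v => k v * f i v / gam e v)]) ->
    k (Q e) @[e --> 0^'+] --> A * k U.
  move=> kZ kS kf; rewrite -kZ mix_momentum kS.
  have QE e : k (Q e) = \sum_(i < N) nu i * m i * k (flux e (f i)).
    by rewrite /Q /mix_flux kS; apply: eq_bigr => i _; rewrite kZ.
  rewrite (funext QE); apply: cvg_sum_ord => i; have [Ik Ek Fk] := kf i.
  have -> : k ((nu i * m i * n i) *: u_nr (f i))
      = nu i * m i * int3 (fun v => k v * f i v) by rewrite kZ Ek mulrA.
  apply: cvgM; first exact: cvg_cst.
  by rewrite (funext Fk); exact: cvg_int3_gam.
have ui i := u_nrE (lt0r_neq0 (mix_n_gt0 i)).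
split.
- apply: (component (fun v => v.1.1)) => // [b|i]; first by rewrite sum_vec3.
  have [_ I1 _ _ _] := fm i; have [E1 _ _] := ui i.
  by split=> // e; have [F1 _ _] := fluxE e (f i).
- apply: (component (fun v => v.1.2)) => // [b|i]; first by rewrite sum_vec3.
  have [_ _ I1 _ _] := fm i; have [_ E1 _] := ui i.
  by split=> // e; have [_ F1 _] := fluxE e (f i).
- apply: (component (fun v => v.2)) => // [b|i]; first by rewrite sum_vec3.
  have [_ _ _ I1 _] := fm i; have [_ _ E1] := ui i.
  by split=> // e; have [_ _ F1] := fluxE e (f i).
Qed.

Lemma cvg_mix_flux_dot v : dot (Q e) v @[e --> 0^'+] --> A * dot U v.
Proof.
have [c1 c2 c3] := cvg_mix_flux.
have -> : A * dot U v = A * U.1.1 * v.1.1 + A * U.1.2 * v.1.2 + A * U.2 * v.2.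
  by rewrite dotE; ring.
by apply: cvgD; [apply: cvgD|]; apply: cvgM => //; exact: cvg_cst.
Qed.

Lemma cvg_mix_flux_sqr : dot (Q e) (Q e) @[e --> 0^'+] --> A ^+ 2 * dot U U.
Proof.
have [c1 c2 c3] := cvg_mix_flux.
have -> : A ^+ 2 * dot U U = A * U.1.1 * (A * U.1.1) + A * U.1.2 * (A * U.1.2)
    + A * U.2 * (A * U.2).
  by rewrite dotE; ring.
by apply: cvgD; [apply: cvgD|]; apply: cvgM.
Qed.

Lemma cvg_mix_norm : S e @[e --> 0^'+] --> A.
Proof.
have c : (A ^+ 2 - e ^+ 2 * dot (Q e) (Q e)) @[e --> 0^'+]
    --> A ^+ 2 - 0 ^+ 2 * (A ^+ 2 * dot U U).
  apply: cvgB; first exact: cvg_cst.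
  apply: cvgM; last exact: cvg_mix_flux_sqr.
  by apply: cvg_comp (@cvg_id0 R) (@exprn_continuous R 2 0).
have := continuous_cvg _ (@sqrt_continuous R _) c.
rewrite expr0n/= mul0r subr0 sqrtr_sqr gtr0_norm; last exact: mass_density_gt0.
by apply.
Qed.

(** [A ^+ 2 - S e ^+ 2 = e ^+ 2 * dot (Q e) (Q e)], divided by [A + S e]. *)
Lemma cvg_mix_norm_defect :
  (A - S e) / e ^+ 2 @[e --> 0^'+] --> A * dot U U / 2.
Proof.
have A0 := mass_density_gt0.
apply: (@cvg_trans _ ((fun e => dot (Q e) (Q e) / (A + S e)) @ 0^'+)).
  apply: near_eq_cvg; near=> e.
  have e0 : 0 < e by [].
  have S0 : 0 < S e by near: e; apply: cvgr_gt cvg_mix_norm _ A0.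
  have S2 : S e ^+ 2 = A ^+ 2 - e ^+ 2 * dot (Q e) (Q e).
    rewrite sqr_sqrtr// ltW//; move: S0; rewrite /S /mix_norm sqrtr_gt0; exact.
  have AS : A + S e != 0 by rewrite gt_eqF ?addr_gt0.
  have -> : dot (Q e) (Q e) = (A ^+ 2 - S e ^+ 2) / e ^+ 2.
    by rewrite S2; field; rewrite gt_eqF.
  by field; rewrite AS gt_eqF.
have AA : A + A != 0 by rewrite gt_eqF ?addr_gt0.
have -> : A * dot U U / 2 = A ^+ 2 * dot U U / (A + A) by field.
apply: cvgM; first exact: cvg_mix_flux_sqr.
apply: cvgV => //.
by apply: cvgD; [exact: cvg_cst|exact: cvg_mix_norm].
Unshelve. all: by end_near. Qed.

(** What the equation for [betat] leaves at order [e ^+ 2] once the rest energy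
    is removed: relativistic corrections of the densities minus that of the flux. *)
Definition energy_balance e : R :=
  \sum_(i < N) nu i * m i * ((n i - J i e) / e ^+ 2) - (A - S e) / e ^+ 2.

Lemma cvg_energy_balance :
  energy_balance e @[e --> 0^'+] --> 3 / 2 * (\sum_(i < N) nu i * n i) * T.
Proof.
rewrite mix_T_energy; apply: cvgB; last exact: cvg_mix_norm_defect.
apply: cvg_sum_ord => i; apply: cvgM; first exact: cvg_cst.
have [If _ _ _ _] := fm i.
have [Iq _] := second_moment (fm i) (lt0r_neq0 (mix_n_gt0 i)).
exact: cvg_int3_gam_defect.
Qed.

Lemma cvg_weighted_density i : J i e @[e --> 0^'+] --> n i.
Proof. by have [If _ _ _ _] := fm i; exact: cvg_int3_gam. Qed.

Variable y : R -> R.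
Hypothesis y_gt0 : forall e, 0 < e -> 0 < y e.
Hypothesis y_eq : forall e, 0 < e ->
  \sum_(i < N) nu i * m i * mean_gam (m i * y e) * J i e = S e.

Lemma excess_balance e : 0 < e ->
  \sum_(i < N) nu i * m i * (mean_gam (m i * y e) - 1) * J i e
  = e ^+ 2 * energy_balance e.
Proof.
move=> e0; rewrite /energy_balance mulrBr mulr_sumr.
transitivity (S e - \sum_(i < N) nu i * m i * J i e).
  by rewrite -(y_eq e0) -sumrB; apply: eq_bigr => i _; ring.
have -> : \sum_(i < N) e ^+ 2 * (nu i * m i * ((n i - J i e) / e ^+ 2))
    = A - \sum_(i < N) nu i * m i * J i e.
  rewrite /A /mass_density -sumrB; apply: eq_bigr => i _; rewrite -/(n i).
  by field; rewrite gt_eqF.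
by field; rewrite gt_eqF.
Qed.

(** If [y e <= M], the monotone mean Lorentz factor keeps the excess energy of the
    species [i0] above a positive constant, while the balance tends to 0. *)
Lemma cvgy_coldness : y e @[e --> 0^'+] --> +oo.
Proof.
apply/cvgryPgt => M0; pose M := Num.max M0 1.
have M1 : 0 < M by rewrite lt_max ltr01 orbT.
pose eta := mean_gam (m i0 * M) - 1.
have eta0 : 0 < eta by rewrite subr_gt0 mean_gam_gt1// mulr_gt0.
have n0 := mix_n_gt0 i0.
pose k := nu i0 * m i0 * eta * (n i0 / 2).
have k0 : 0 < k by rewrite /k !mulr_gt0.
have c0 : e ^+ 2 * energy_balance e @[e --> 0^'+] --> (0 : R).
  have c2 : e ^+ 2 @[e --> 0^'+] --> (0 ^+ 2 : R).
    by apply: cvg_comp (@cvg_id0 R) (@exprn_continuous R 2 0).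
  by have := cvgM c2 cvg_energy_balance; rewrite expr0n/= mul0r; apply.
have n2 : n i0 / 2 < n i0 by rewrite ltr_pdivrMr// ltr_pMr// ltr1n.
have nJ : \forall e \near 0^'+, n i0 / 2 < J i0 e.
  by apply: cvgr_gt (@cvg_weighted_density i0) _ n2.
near=> e; have e0 : 0 < e by [].
apply: (@le_lt_trans _ _ M); first by rewrite le_max lexx.
rewrite ltNge; apply/negP => yM.
have Jn : n i0 / 2 < J i0 e.
  by near: e; exact: nJ.
have bk : e ^+ 2 * energy_balance e < k by near: e; apply: cvgr_lt c0 _ k0.
move: bk; apply/negP; rewrite -leNgt -excess_balance// (bigD1 i0)//=.
have pos i : 0 <= nu i * m i * (mean_gam (m i * y e) - 1) * J i e.
  apply: mulr_ge0; last first.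
    by apply: int3_ge0 => v; rewrite divr_ge0// ltW// gam_gt0.
  apply: mulr_ge0; first by rewrite ltW// mulr_gt0.
  by rewrite subr_ge0 ltW// mean_gam_gt1// mulr_gt0// y_gt0.
rewrite -[k]addr0 lerD ?sumr_ge0//.
rewrite /k; apply: ler_pM; [| | |exact: ltW].
- by rewrite ltW// !mulr_gt0.
- by rewrite ltW// divr_gt0.
rewrite ler_pM2l ?mulr_gt0// lerD2r mean_gam_nonincreasing ?mulr_gt0 ?y_gt0//.
by rewrite ler_pM2l.
Unshelve. all: by end_near. Qed.

Lemma cvg_thermal_width i : (Num.sqrt (m i * y e))^-1 @[e --> 0^'+] --> 0^'+.
Proof.
pose d e := (Num.sqrt (m i * y e))^-1.
move=> P [/= r r0 rP]; suff : \forall e \near 0^'+, P (d e) by [].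
near=> e; have e0 : 0 < e by [].
have d0 : 0 < d e by rewrite invr_gt0 sqrtr_gt0 mulr_gt0// y_gt0.
apply: rP => //=; rewrite sub0r normrN gtr0_norm//.
have yr : r ^- 2 / m i < y e.
  by near: e; move: (r ^- 2 / m i); apply/cvgryPgt; exact: cvgy_coldness.
rewrite /d -[r]invrK ltf_pV2 ?posrE ?invr_gt0 ?sqrtr_gt0 ?mulr_gt0 ?y_gt0//.
rewrite -[r^-1]gtr0_norm ?invr_gt0// -sqrtr_sqr ltr_sqrt ?mulr_gt0 ?y_gt0//.
by rewrite exprVn mulrC -ltr_pdivrMr.
Unshelve. all: by end_near. Qed.

(** By [mean_gamE], [y e] times the excess energy is a sum of thermal ratios, which
    have the limit [3 / 2]; the quotient of this sum by the energy balance is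
    [e ^+ 2 * y e]. *)
Lemma cvg_coldness : e ^+ 2 * y e @[e --> 0^'+] --> T^-1.
Proof.
pose d i e := (Num.sqrt (m i * y e))^-1.
have cG i : juttner_energy (d i e) / juttner_mass (d i e) @[e --> 0^'+] --> (3 / 2 : R).
  exact: cvg_comp (@cvg_thermal_width i) cvg_thermal_ratio.
have T0 := mix_T_gt0.
pose C := 3 / 2 * (\sum_(i < N) nu i * n i).
have C0 : 0 < C.
  by rewrite mulr_gt0// mix_sum_gt0// => i; rewrite mulr_gt0// mix_n_gt0.
have cL : \sum_(i < N) nu i * (juttner_energy (d i e) / juttner_mass (d i e)) * J i e
    @[e --> 0^'+] --> C.
  have -> : C = \sum_(i < N) nu i * (3 / 2) * n i.
    by rewrite /C mulr_sumr; apply: eq_bigr => i _; ring.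
  apply: cvg_sum_ord => i; apply: cvgM; last exact: cvg_weighted_density.
  by apply: cvgM; [exact: cvg_cst|exact: cG].
have CT : 0 < C * T by rewrite mulr_gt0.
have -> : T^-1 = C / (C * T) by field; rewrite !gt_eqF.
apply: (@cvg_trans _ ((fun e => (\sum_(i < N) nu i *
   (juttner_energy (d i e) / juttner_mass (d i e)) * J i e) / energy_balance e) @ 0^'+)).
  apply: near_eq_cvg; near=> e.
  have e0 : 0 < e by [].
  have B0 : 0 < energy_balance e by near: e; apply: cvgr_gt cvg_energy_balance _ CT.
  have y0 := y_gt0 e0.
  apply: (mulIf (lt0r_neq0 B0)); rewrite divfK ?gt_eqF//.
  have -> : e ^+ 2 * y e * energy_balance e = y e * (e ^+ 2 * energy_balance e) by ring.
  rewrite -excess_balance// mulr_sumr; apply: eq_bigr => i _.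
  rewrite mean_gamE ?mulr_gt0// -/(d i e).
  by field; rewrite !gt_eqF// juttner_mass_gt0// /d invr_gt0 sqrtr_gt0 mulr_gt0.
apply: cvgM => //; apply: cvgV; first by rewrite gt_eqF.
exact: cvg_energy_balance.
Unshelve. all: by end_near. Qed.


End MixtureLimits.

(** * The attractor *)

Lemma powR_3half (R : realType) (a : R) : 0 <= a -> a `^ (3 / 2) = Num.sqrt a ^+ 3.
Proof.
by move=> a0; rewrite -powR12_sqrt// -powR_mulrn ?powR_ge0// -powRrM mulrC.
Qed.

(** The exponent of the attractor and the integral that normalises it both carry
    [exp (- x)]; what remains depends on [x] through [e ^+ 2 * x] and the
    mass [juttner_mass]. *)
Lemma JbarE (R : realType) (N : nat) (c : R) (m nu tau : 'I_N -> R)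
    (f : 'I_N -> vec3 R -> R) (s e b : R) (i : 'I_N) (v : vec3 R)
    (x := m i * (c ^+ 2 * b)) (A := mass_density m nu f)
    (S := mix_norm m nu f e) (Q := mix_flux m nu f e) :
  0 < s -> (forall i, 0 < tau i /\ nu i = s / tau i) ->
  0 < e -> 0 < x -> 0 < S ->
  Jbar c m tau f e b i v
  = int3 (fun w => f i w / gam e w) / juttner_mass (Num.sqrt x)^-1
    * Num.sqrt (e ^+ 2 * x) ^+ 3
    * expR (- (e ^+ 2 * x *
        ((A - S) / e ^+ 2 * (gam e v / S) + kin e v - dot Q v / S))).
Proof.
move=> s0 taus e0 x0 S0; rewrite /Jbar (UbarE m f e s0 taus) -/A -/S -/Q.
have -> : m i * c ^+ 2 * b = x by rewrite /x mulrA.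
clearbody x.
have [_ _ -> _] := int3_juttner_scaling x0 e0.
set Z := juttner_mass _.
have Z0 : Z != 0 by rewrite gt_eqF// juttner_mass_gt0// invr_gt0 sqrtr_gt0.
have sx : Num.sqrt x != 0 by rewrite gt_eqF ?sqrtr_gt0.
have eN0 : e != 0 by rewrite gt_eqF.
have SN0 : S != 0 by rewrite gt_eqF.
rewrite sqrtrM ?sqr_ge0// sqrtr_sqr gtr0_norm// /=.
rewrite !dotZl.
set J := int3 _; set g := gam e v; set E := expR (- x); have E0 : E != 0 by rewrite gt_eqF ?expR_gt0.
have -> : - (x * (S^-1 *: A * g - e * (S^-1 * (e * dot Q v))))
   = - x + - (e ^+ 2 * x * ((A - S) / e ^+ 2 * (g / S) + kin e v - dot Q v / S)).
  by rewrite /kin -/g /GRing.scale/=; field; rewrite eN0 SN0.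
rewrite expRD -/E.
by field; rewrite Z0 E0 sx eN0.
Qed.

Unset Implicit Arguments.

Theorem proposition6p1 (R : realType) (N : nat)
  (c : R) (m nu : 'I_N -> R) (fbar : 'I_N -> vec3 R -> R)
  (s L Nd : R -> R) (tau : R -> 'I_N -> R) (betat : R -> R)
  (c_gt0 : 0 < c) (m_gt0 : forall i, 0 < m i)
  (scales : forall eps : R, 0 < eps ->
     [/\ 0 < s eps, 0 < L eps, 0 < Nd eps & eps = L eps / (c * s eps)])
  (relax : forall eps : R, 0 < eps -> forall i,
     0 < tau eps i /\ nu i = s eps / tau eps i)
  (fbar_ge0 : forall i v, 0 <= fbar i v)
  (fbar_moments : forall i, finite_moments (fbar i))
  (fbar_neq0 : forall i, ~ {ae leb3 R, forall v, fbar i v = 0})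
  (betatP : forall eps : R, 0 < eps ->
     unique
       (betat_solution c m (tau eps)
          (fun i => dimensional (Nd eps) (m i * L eps / s eps) (fbar i)))
       (betat eps)) :
  forall (i : 'I_N) (v : vec3 R),
    Jbar c m (tau eps) fbar eps (betat eps) i v @[eps --> 0^'+]
      --> maxwellian nu m fbar i v.

Proof.
have nu_gt0 i : 0 < nu i.
  have [s0 _ _ _] := scales 1 ltr01; have [t0 ->] := relax 1 ltr01 i.
  by rewrite divr_gt0.
pose y e := c ^+ 2 * betat e.
have sol e : 0 < e -> 0 < betat e /\ _ := fun e0 =>
  let: And4 s0 L0 N0 eE := scales e e0 in
  betat_equation c_gt0 m_gt0 fbar_moments s0 N0 e0 eE (relax e e0) (betatP e e0).1.
have y_gt0 e : 0 < e -> 0 < y e.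
  by move=> e0; have [b0 _] := sol e e0; rewrite mulr_gt0 ?exprn_gt0.
have y_eq e (e0 : 0 < e) := (sol e e0).2.
move=> i v.
have cold := cvg_coldness m_gt0 nu_gt0 fbar_ge0 fbar_moments fbar_neq0 i y_gt0 y_eq.
have T0 := mix_T_gt0 m_gt0 nu_gt0 fbar_ge0 fbar_moments fbar_neq0 i.
have A0 := mass_density_gt0 m_gt0 nu_gt0 fbar_ge0 fbar_moments fbar_neq0 i.
have cS := cvg_mix_norm m_gt0 nu_gt0 fbar_ge0 fbar_moments fbar_neq0 i.
have cSd := cvg_mix_norm_defect m_gt0 nu_gt0 fbar_ge0 fbar_moments fbar_neq0 i.
have cQ := cvg_mix_flux_dot m_gt0 nu_gt0 fbar_ge0 fbar_moments fbar_neq0 i.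
have [If _ _ _ _] := fbar_moments i.
have cJ := cvg_int3_gam If.
set T := mix_T nu m fbar in cold T0 *.
set A := mass_density m nu fbar in A0 cS cSd cQ *.
set U := mix_U nu m fbar in cSd cQ *.
pose S := mix_norm m nu fbar; pose Q := mix_flux m nu fbar.
have AN0 : A != 0 by rewrite gt_eqF.
have TN0 : T != 0 by rewrite gt_eqF.
have mi0 := m_gt0 i.
have ck : e ^+ 2 * (m i * y e) @[e --> 0^'+] --> m i / T.
  under eq_fun do rewrite mulrCA.
  by apply: cvgM => //; exact: cvg_cst.
have cd : (Num.sqrt (m i * y e))^-1 @[e --> 0^'+] --> 0^'+.
  exact: (cvg_thermal_width m_gt0 nu_gt0 fbar_ge0 fbar_moments fbar_neq0 i y_gt0 y_eq).
have cSi : (S e)^-1 @[e --> 0^'+] --> A^-1 by apply: cvgV.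
have cX : e ^+ 2 * (m i * y e) * ((A - S e) / e ^+ 2 * (gam e v / S e) + kin e v
     - dot (Q e) v / S e) @[e --> 0^'+]
   --> m i / T * ((A * dot U U / 2) * (1 / A) + dot v v / 2 - A * dot U v / A).
  apply: cvgM => //; apply: cvgB; last exact: cvgM.
  apply: cvgD; last exact: cvg_kin.
  by apply: cvgM => //; apply: cvgM => //; exact: cvg_gam.
have cZ : juttner_mass (Num.sqrt (m i * y e))^-1 @[e --> 0^'+]
    --> Num.sqrt (2 * pi : R) ^+ 3.
  exact: cvg_comp cd (@cvg_juttner_mass R).
have Z0 : Num.sqrt (2 * pi : R) ^+ 3 != 0.
  by rewrite gt_eqF// exprn_gt0// sqrtr_gt0 mulr_gt0// pi_gt0.
have cR : Num.sqrt (e ^+ 2 * (m i * y e)) ^+ 3 @[e --> 0^'+] --> Num.sqrt (m i / T) ^+ 3.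
  have c1 : Num.sqrt (e ^+ 2 * (m i * y e)) @[e --> 0^'+] --> Num.sqrt (m i / T).
    exact: (continuous_cvg _ (@sqrt_continuous R _) ck).
  exact: cvgM c1 (cvgM c1 c1).
have limE : maxwellian nu m fbar i v = n_nr (fbar i) / Num.sqrt (2 * pi : R) ^+ 3
    * Num.sqrt (m i / T) ^+ 3
    * expR (- (m i / T * ((A * dot U U / 2) * (1 / A) + dot v v / 2 - A * dot U v / A))).
  rewrite /maxwellian -/T -/U.
  have piT : 0 < 2 * pi * T by rewrite mulr_gt0// mulr_gt0// pi_gt0.
  rewrite powR_3half; last by rewrite ltW// divr_gt0.
  have -> : m i / (2 * pi * T) = m i / T / (2 * pi).
    by rewrite [2 * pi * T]mulrC invfM mulrA.
  have -> : Num.sqrt (m i / T / (2 * pi)) = Num.sqrt (m i / T) / Num.sqrt (2 * pi).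
    have mT : 0 <= m i / T by rewrite ltW// divr_gt0.
    by rewrite sqrtrM// sqrtrV// mulr_ge0// pi_ge0.
  rewrite dotB.
  have -> : m i * (dot v v - 2 * dot U v + dot U U) / (2 * T)
    = m i / T * (A * dot U U / 2 * (1 / A) + dot v v / 2 - A * dot U v / A).
    by field; rewrite AN0 TN0.
  congr (_ * _); rewrite exprMn exprVn -mulrA; congr (_ * _); exact: mulrC.
rewrite limE.
pose F e := int3 (fun w => fbar i w / gam e w) / juttner_mass (Num.sqrt (m i * y e))^-1
    * Num.sqrt (e ^+ 2 * (m i * y e)) ^+ 3
    * expR (- (e ^+ 2 * (m i * y e) *
        ((A - S e) / e ^+ 2 * (gam e v / S e) + kin e v - dot (Q e) v / S e))).
apply: (@cvg_trans _ (F @ 0^'+)).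
  apply: near_eq_cvg; near=> e; have e0 : 0 < e by [].
  have [s0 _ _ _] := scales e e0.
  rewrite /F (JbarE v s0 (relax e e0) e0)//.
    by rewrite mulr_gt0 ?y_gt0.
  by near: e; apply: cvgr_gt cS _ A0.
apply: cvgM.
  apply: cvgM => //; apply: cvgM => //.
  by apply: cvgV.
apply: continuous_cvg; first exact: continuous_expR.
by apply: cvgN.
Unshelve. all: by end_near. Qed.
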